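(* Let the number $p$ of groups be fixed, let $\tau\in(0,1)$, and consider the linear model $Y_i=\sum_{j=1}^p \mathbf{X}_{ij}^t\boldsymbol\beta^0_j+\varepsilon_i=\mathbb{X}_i^t\boldsymbol\beta^0+\varepsilon_i$, $i=1,\dots,n$, with grouped explanatory variables, described in the context. Suppose that assumptions (A1) and (A2) of the context hold, and that the tuning parameter $\mu_n>0$ and the constant $\gamma>0$ satisfy, as $n\to\infty$, $$\mu_n\to\infty,\qquad \frac{\mu_n}{\sqrt n}\to 0,\qquad n^{(\gamma-1)/2}\mu_n\to\infty,\qquad n^{\gamma/2-1}\mu_n\to\infty .$$ Let $\widehat{\boldsymbol\beta}^*_n$ be the adaptive group LASSO quantile estimator defined in the context and let $\widehat{\mathcal A}^*_n=\{j\in\{1,\dots,p\}:\|\widehat{\boldsymbol\beta}^*_{n;j}\|\ne0\}$. Then $$\lim_{n\to\infty}\mathbb P\big[\widehat{\mathcal A}^*_n=\mathcal A\big]=1 .$$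
   Context: Model. The number of groups $p$ and the group sizes $d_1,\dots,d_p$ are fixed; $r=\sum_{j=1}^p d_j$. For $i=1,\dots,n$, $\mathbf X_{ij}\in\mathbb R^{d_j}$ is the (nonrandom) design of group $j$, $\mathbb X_i=(\mathbf X_{i1},\dots,\mathbf X_{ip})\in\mathbb R^r$ (column vector), and $Y_i=\mathbb X_i^t\boldsymbol\beta^0+\varepsilon_i$, where $\boldsymbol\beta^0=(\boldsymbol\beta^0_1,\dots,\boldsymbol\beta^0_p)\in\mathbb R^r$, $\boldsymbol\beta^0_j\in\mathbb R^{d_j}$, is the true (unknown) parameter. A generic parameter is $\boldsymbol\beta=(\boldsymbol\beta_1,\dots,\boldsymbol\beta_p)$. $\|\cdot\|$ is the Euclidean norm. The groups are ordered so that $\|\boldsymbol\beta^0_j\|\ne0$ for $j\le p_0$ and $\|\boldsymbol\beta^0_j\|=0$ for $j>p_0$, with $p_0\le p$. Let $\mathcal A=\{j:\|\boldsymbol\beta_j^0\|\neq 0\}=\{1,\dots,p_0\}$. Estimators. The check function is $\rho_\tau(u)=u(\tau-\mathbf 1_{u<0})$. The quantile estimator is $\widetilde{\boldsymbol\beta}_n=(\widetilde{\boldsymbol\beta}_{n;1},\dots,\widetilde{\boldsymbol\beta}_{n;p})=\arg\min_{\boldsymbol\beta\in\mathbb R^r}\sum_{i=1}^n\rho_\tau(Y_i-\mathbb X_i^t\boldsymbol\beta)$. The weights are $\widehat\omega_{n;j}=\|\widetilde{\boldsymbol\beta}_{n;j}\|^{-\gamma}$. The adaptive group LASSO quantile estimator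 is $$\widehat{\boldsymbol\beta}^*_n=(\widehat{\boldsymbol\beta}^*_{n;1},\dots,\widehat{\boldsymbol\beta}^*_{n;p})=\arg\min_{\boldsymbol\beta\in\mathbb R^r}\Big\{\sum_{i=1}^n\rho_\tau\Big(Y_i-\sum_{j=1}^p\mathbf X_{ij}^t\boldsymbol\beta_j\Big)+\mu_n\sum_{j=1}^p\widehat\omega_{n;j}\|\boldsymbol\beta_j\|\Big\}.$$ Assumptions. (A1) As $n\to\infty$, $n^{-1}\max_{1\le i\le n}\mathbb X_i^t\mathbb X_i\to0$ and $n^{-1}\sum_{i=1}^n\mathbb X_i\mathbb X_i^t\to\boldsymbol\Upsilon$, with $\boldsymbol\Upsilon$ an $r\times r$ positive definite matrix. (A2) $(\varepsilon_i)_{1\le i\le n}$ are independent and identically distributed, with distribution function $F:\mathcal B\to[0,1]$, where $\mathcal B$ is a real set with $0\in\mathcal B$, and with a density $f$ that is continuous and positive in a neighborhood of $0$. The $\tau$th quantile of $\varepsilon_i$ is zero: $\tau=F(0)$. Moreover, for every $e\in\mathrm{int}(\mathcal B)$, $$\lim_{n\to\infty}n^{-1}\sum_{i=1}^n\int_0^{\mathbb X_i^t\mathbf 1_r}\sqrt n\,\big[F(e+v/\sqrt n)-F(e)\big]\,dv=\tfrac12 f(e)\,\mathbf 1_r^t\boldsymbol\Upsilon\mathbf 1_r,$$ where $\mathbf 1_r$ is the $r$-vector with all components equal to $1$. *)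

(* Defs.v *)
From HB Require Import structures.
From mathcomp Require Import all_boot all_order all_algebra.
From mathcomp Require Import all_classical all_reals all_analysis.
Set Implicit Arguments.
Unset Strict Implicit.
Unset Printing Implicit Defensive.
Import Order.TTheory GRing.Theory Num.Theory.
Import numFieldNormedType.Exports.
Local Open Scope classical_set_scope.
Local Open Scope ring_scope.

(* R^r with r = d_1 + ... + d_p; the j-th block of b is [submxcol b j]. *)
Notation grouped R d := 'cV[R]_(\sum_j d j)%N.

Definition dotv (R : realType) (n : nat) (x y : 'cV[R]_n) : R :=
  (x^T *m y) ord0 ord0.

(* The library's norm on matrices is the sup norm, not this one. *)
Definition enorm (R : realType) (n : nat) (x : 'cV[R]_n) : R :=
  Num.sqrt (dotv x x).

Definition pos_def (R : realType) (n : nat) (M : 'M[R]_n) : Prop :=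
  M^T = M /\ forall v : 'cV[R]_n, v != 0 -> 0 < dotv v (M *m v).

Definition check_fun (R : realType) (tau u : R) : R :=
  u * (tau - (u < 0)%R%:R).

Definition is_argmin disp (V : Type) (L : porderType disp) (g : V -> L) (b : V)
    : Prop :=
  forall b' : V, (g b <= g b')%O.

Definition active_set (R : realType) (p : nat) (d : 'I_p -> nat)
    (b : grouped R d) : {set 'I_p} :=
  finset (fun j => enorm (submxcol b j) != 0).

Definition quantile_loss (R : realType) (p : nat) (d : 'I_p -> nat) (tau : R)
    (n : nat) (X : nat -> grouped R d) (y : nat -> R) (b : grouped R d) : R :=
  \sum_(i < n) check_fun tau (y i - dotv (X i) b).

(* ||b||^{-gamma}, equal to +oo at b = 0. The case split is needed because
   [0 `^ (- gamma)] is 0. *)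
Definition adaptive_weight (R : realType) (n : nat) (gamma : R) (b : 'cV[R]_n)
    : \bar R :=
  if enorm b == 0 then +oo%E else (enorm b `^ (- gamma))%:E.

(* Extended-real valued since a weight may be +oo; as +oo * 0 = 0 in [\bar R],
   an infinite weight forces the corresponding group of a minimizer to 0. *)
Definition adaptive_loss (R : realType) (p : nat) (d : 'I_p -> nat)
    (tau gamma mu : R) (n : nat) (X : nat -> grouped R d) (y : nat -> R)
    (btilde b : grouped R d) : \bar R :=
  ((\sum_(i < n)
      check_fun tau (y i - \sum_(j < p) dotv (submxcol (X i) j) (submxcol b j)))%:E
   + mu%:E * \sum_(j < p)
       adaptive_weight gamma (submxcol btilde j) * (enorm (submxcol b j))%:E)%E.

Definition random_vector dT (T : measurableType dT) (R : realType) (n : nat)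
    (Z : T -> 'cV[R]_n) : Prop :=
  forall k : 'I_n, measurable_fun [set: T] (fun t => Z t k ord0).

Definition independent_RVs dT (T : measurableType dT) (R : realType)
    (P : probability T R) (Z : nat -> {RV P >-> R}) : Prop :=
  forall (J : seq nat) (S : nat -> set R),
    uniq J -> (forall i, measurable (S i)) ->
    P (\bigcap_(i in [set` J]) (Z i @^-1` S i)) =
      (\prod_(i <- J) P (Z i @^-1` S i))%E.

Definition identically_distributed dT (T : measurableType dT) (R : realType)
    (P : probability T R) (Z : nat -> {RV P >-> R}) : Prop :=
  forall (i k : nat) (S : set R), measurable S ->
    distribution P (Z i) S = distribution P (Z k) S.

Definition has_density dT (T : measurableType dT) (R : realType)
    (P : probability T R) (Z : {RV P >-> R}) (f : R -> R) : Prop :=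
  [/\ measurable_fun [set: R] f, forall x, 0 <= f x &
      forall S : set R, measurable S ->
        distribution P Z S = (\int[lebesgue_measure]_(x in S) (f x)%:E)%E].

(* The integral of g from a to b, where b < a is allowed. *)
Definition oriented_integral (R : realType) (a b : R) (g : R -> R) : R :=
  if a <= b then (\int[lebesgue_measure]_(v in `[a, b]) g v)%R
  else - (\int[lebesgue_measure]_(v in `[b, a]) g v)%R.

(* Observations are numbered from 0: i < n stands for i = 1, ..., n. *)
Record design_assumption (R : realType) (r : nat) (X : nat -> 'cV[R]_r)
    (Upsilon : 'M[R]_r) : Prop := DesignAssumption {
  design_max :
    n%:R^-1 * \big[Num.max/0]_(i < n) dotv (X i) (X i) @[n --> \oo] --> (0 : R);
  design_gram :
    n%:R^-1 *: \sum_(i < n) (X i *m (X i)^T) @[n --> \oo] --> Upsilon;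
  design_pos_def : pos_def Upsilon
}.

(* F is the distribution function on the whole line; the set B, in which the
   errors take their values, only matters through its interior. *)
Record error_assumption dT (T : measurableType dT) (R : realType)
    (P : probability T R) (r : nat) (X : nat -> 'cV[R]_r) (Upsilon : 'M[R]_r)
    (tau : R) (eps : nat -> {RV P >-> R}) (B : set R) (F f : R -> R) : Prop :=
  ErrorAssumption {
  error_indep : independent_RVs eps;
  error_ident : identically_distributed eps;
  error_support : forall i, {ae P, forall t, B (eps i t)};
  error_zero : B 0;
  error_cdf : forall i x, (F x)%:E = cdf (eps i) x;
  error_density : forall i, has_density (eps i) f;
  error_density0 : \forall x \near (0 : R), {for x, continuous f} /\ 0 < f x;
  error_quantile : tau = F 0;
  error_limit : forall e : R, B° e ->
    n%:R^-1 * \sum_(i < n)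
      oriented_integral 0 (dotv (X i) (const_mx 1))
        (fun v => Num.sqrt n%:R * (F (e + v / Num.sqrt n%:R) - F e))
      @[n --> \oo] -->
    2^-1 * f e * dotv (const_mx 1) (Upsilon *m const_mx 1)
}.

(* Main.v *)
Require Import Defs.
From HB Require Import structures.
From mathcomp Require Import all_boot all_order all_algebra.
From mathcomp Require Import all_classical all_reals all_analysis.
From mathcomp Require Import measurable_realfun.
From mathcomp Require Import ring lra.
Set Implicit Arguments.
Unset Strict Implicit.
Unset Printing Implicit Defensive.
Import Order.TTheory GRing.Theory Num.Theory.
Import numFieldNormedType.Exports.
Local Open Scope classical_set_scope.
Local Open Scope ring_scope.

(** Write [u = sqrt n * (b - beta0)].  By Knight's identity the centred quantile
    loss is [G u = - <W, u> + sum_i rem_i u], where the score [W] is tight and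
    the remainders are nonnegative, with slopes and curvatures controlled by
    weighted sums of indicators of the independent errors.  One Chebyshev bound
    for such sums shows that, off a set of small probability, [G] is Lipschitz
    on a ball of radius [M] and, through a finite net, at least 1 on its
    boundary.  Convexity along rays then gives [|u| / M <= G u] outside the
    ball, so both estimators lie within [M / sqrt n] of [beta0]; for the
    penalized one this uses [mu_n / sqrt n -> 0].  If an inactive block [b_j] of
    that estimator were nonzero, zeroing it would cost at most a constant times
    [sqrt n * |b_j|] in the loss, but gain at least
    [mu_n * (M / sqrt n)^(-gamma) * |b_j|] in the penalty, which is larger since
    [n^((gamma - 1) / 2) * mu_n -> +oo]. *)

(** * Chebyshev's inequality for independent indicators *)

Lemma integrable_affine_indicM dT (T : measurableType dT) (R : realType)
    (P : probability T R) (A B : set T) (c a b : R) :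
  measurable A -> measurable B ->
  P.-integrable setT (EFin \o (fun t => c * ((\1_A t - a) * (\1_B t - b)))).
Proof.
move=> mA mB; apply: measurable_bounded_integrable => //.
- by rewrite (le_lt_trans (probability_le1 P measurableT)) ?ltry.
- apply: measurable_funM => //; apply: measurable_funM;
    by apply: measurable_funB => //; exact: measurable_indic.
- exists (`|c| * ((1 + `|a|) * (1 + `|b|))); split; first exact: num_real.
  move=> M /ltW le_M t _; apply: le_trans le_M; rewrite !normrM.
  apply: ler_wpM2l => //; apply: ler_pM => //.
    rewrite (le_trans (ler_normB _ _))// lerD2r.
    by rewrite indicE; case: (t \in A); rewrite ?normr1 ?normr0.
  rewrite (le_trans (ler_normB _ _))// lerD2r.
  by rewrite indicE; case: (t \in B); rewrite ?normr1 ?normr0.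
Qed.

Lemma integral_indic_cov dT (T : measurableType dT) (R : realType)
    (P : probability T R) (A B : set T) (c : R) :
  measurable A -> measurable B ->
  (\int[P]_t (c * ((\1_A t - fine (P A)) * (\1_B t - fine (P B))))%:E =
  (c * (fine (P (A `&` B)) - fine (P A) * fine (P B)))%:E)%E.
Proof.
move=> mA mB.
have Lin C : measurable C -> (\1_C : T -> R) \in Lfun P 1.
  by move=> mC; rewrite Lfun1_integrable; exact: integrable_indic.
have EI C : measurable C -> ('E_P[\1_C] = (fine (P C))%:E)%E.
  by move=> mC; rewrite expectation_indic// fineK// fin_num_measure.
have AB : (\1_A * \1_B : T -> R) = \1_(A `&` B) by rewrite indicI.
have cAB : covariance P \1_A \1_B =
    (fine (P (A `&` B)) - fine (P A) * fine (P B))%:E.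
  rewrite covarianceE ?AB ?Lin//; last exact: measurableI.
  by rewrite !EI//; exact: measurableI.
under eq_integral do rewrite EFinM.
rewrite integralZl//; last first.
  have := integrable_affine_indicM P 1 (fine (P A)) (fine (P B)) mA mB.
  by apply: eq_integrable => // t _ /=; rewrite mul1r.
rewrite [RHS]EFinM -cAB; congr (_ * _)%E.
by rewrite covariance.unlock !expectation_indic// unlock.
Qed.

(** Expanding the square of the centred sum, pairwise independence kills the off-diagonal
    covariances, and each diagonal term carries [p - p * p <= p]. Keeping [p] in the bound makes it
    small when the events are rare. *)
Lemma chebyshev_indep_indic dT (T : measurableType dT) (R : realType)
    (P : probability T R) (n : nat) (A : 'I_n -> set T) (a : 'I_n -> R) (l : R) :
  0 < l -> (forall i, measurable (A i)) ->
  (forall i k, i != k -> P (A i `&` A k) = (P (A i) * P (A k))%E) ->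
  (P [set t | (l <= `|\sum_(i < n) a i * (\1_(A i) t - fine (P (A i)))|)%R]
   <= ((\sum_(i < n) a i ^+ 2 * fine (P (A i))) / l ^+ 2)%:E)%E.
Proof.
move=> l0 mA indep.
set Z := fun t => \sum_(i < n) a i * (\1_(A i) t - fine (P (A i))).
have mZ : measurable_fun setT Z.
  apply: measurable_sum => i; apply: measurable_funM => //.
  by apply: measurable_funB => //; exact: measurable_indic.
pose g i k t :=
  a i * a k * ((\1_(A i) t - fine (P (A i))) * (\1_(A k) t - fine (P (A k)))).
have Z2 t : Z t ^+ 2 = \sum_(i < n) \sum_(k < n) g i k t.
  rewrite expr2 mulr_suml; apply: eq_bigr => i _.
  by rewrite mulr_sumr; apply: eq_bigr => k _; rewrite /g; ring.
have EZ2 : (\int[P]_t (Z t ^+ 2)%:E <= (\sum_(i < n) a i ^+ 2 * fine (P (A i)))%:E)%E.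
  under eq_integral => t _.
    rewrite Z2 -sumEFin; under eq_bigr do rewrite -sumEFin; over.
  rewrite integral_sum//; last first.
    move=> i; apply: integrable_sum => // k _; exact: integrable_affine_indicM.
  rewrite -sumEFin; apply: lee_sum => i _.
  rewrite integral_sum//; last by move=> k; exact: integrable_affine_indicM.
  under eq_bigr do rewrite integral_indic_cov//.
  rewrite (bigD1 i)//= big1 ?adde0 => [|k ki]; last first.
    by rewrite indep 1?eq_sym// fineM ?fin_num_measure// subrr mulr0.
  rewrite setIid lee_fin -expr2 ler_wpM2l ?sqr_ge0// gerBl.
  by apply: mulr_ge0; rewrite fine_ge0.
(* Markov's inequality for [Z ^+ 2] at level [l ^+ 2]. *)
have := @le_integral_comp_abse _ T R P setT measurableT (EFin \o (fun t => Z t ^+ 2))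
  (l ^+ 2) id (@measurable_id _ _ _).
move=> /(_ (fun _ h => h) (fun _ _ _ _ h => h)).
have mZ2 : measurable_fun setT (EFin \o (fun t => Z t ^+ 2)).
  by apply/measurable_EFinP; exact: measurable_funX.
move=> /(_ mZ2); rewrite exprn_gt0// => /(_ isT) H.
rewrite EFinM muleC lee_pdivlMl ?exprn_gt0//.
apply: le_trans EZ2; apply: le_trans (le_trans H _).
  rewrite setTI; apply: lee_wpmul2l; first by rewrite lee_fin sqr_ge0.
  rewrite (_ : [set t | _] = [set x | ((l ^+ 2)%:E <= `|(Z x ^+ 2)%:E|)%E])//.
  apply/seteqP; split => t /=; rewrite lee_fin normrX.
    by rewrite ler_pXn2r ?nnegrE// ltW.
  by rewrite ler_pXn2r ?nnegrE// ltW.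
rewrite le_eqVlt; apply/orP; left; apply/eqP; apply: eq_integral => t _ /=.
by rewrite ger0_norm ?sqr_ge0.
Qed.

(** * Euclidean norm, nets, positive definite forms *)

Section euclidean.
Context {R : realType}.

Lemma dotvE n (x y : 'cV[R]_n) : dotv x y = \sum_k x k ord0 * y k ord0.
Proof. by rewrite /dotv mxE; apply: eq_bigr => k _; rewrite mxE. Qed.

Lemma dotvC n (x y : 'cV[R]_n) : dotv x y = dotv y x.
Proof. by rewrite !dotvE; apply: eq_bigr => k _; rewrite mulrC. Qed.

Lemma dotvDr n (x y z : 'cV[R]_n) : dotv x (y + z) = dotv x y + dotv x z.
Proof. by rewrite /dotv mulmxDr mxE. Qed.

Lemma dotvDl n (x y z : 'cV[R]_n) : dotv (x + y) z = dotv x z + dotv y z.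
Proof. by rewrite ![dotv _ z]dotvC dotvDr. Qed.

Lemma dotvZr n a (x y : 'cV[R]_n) : dotv x (a *: y) = a * dotv x y.
Proof. by rewrite /dotv -scalemxAr mxE. Qed.

Lemma dotvZl n a (x y : 'cV[R]_n) : dotv (a *: x) y = a * dotv x y.
Proof. by rewrite ![dotv _ y]dotvC dotvZr. Qed.

Lemma dotvNr n (x y : 'cV[R]_n) : dotv x (- y) = - dotv x y.
Proof. by rewrite -scaleN1r dotvZr mulN1r. Qed.

Lemma dotvBr n (x y z : 'cV[R]_n) : dotv x (y - z) = dotv x y - dotv x z.
Proof. by rewrite dotvDr dotvNr. Qed.

Lemma dotv0r n (x : 'cV[R]_n) : dotv x 0 = 0.
Proof. by rewrite -(scale0r 0) dotvZr mul0r. Qed.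

Lemma dotvv_ge0 n (x : 'cV[R]_n) : 0 <= dotv x x.
Proof. by rewrite dotvE sumr_ge0// => k _; rewrite -expr2 sqr_ge0. Qed.

Lemma enorm_ge0 n (x : 'cV[R]_n) : 0 <= enorm x.
Proof. exact: sqrtr_ge0. Qed.

Lemma sqr_enorm n (x : 'cV[R]_n) : enorm x ^+ 2 = dotv x x.
Proof. by rewrite sqr_sqrtr// dotvv_ge0. Qed.

Lemma enorm_eq0 n (x : 'cV[R]_n) : (enorm x == 0) = (x == 0).
Proof.
apply/idP/eqP => [|->]; last by rewrite /enorm dotv0r sqrtr0.
rewrite -(@sqrf_eq0 R) sqr_enorm dotvE psumr_eq0; last first.
  by move=> k _; rewrite -expr2 sqr_ge0.
move=> /allP x0; apply/matrixP => k j; rewrite ord1 mxE.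
by have := x0 k (mem_index_enum _); rewrite mulf_eq0 orbb => /eqP.
Qed.

Lemma enorm0 n : enorm (0 : 'cV[R]_n) = 0.
Proof. by apply/eqP; rewrite enorm_eq0. Qed.

Lemma enormZ n a (x : 'cV[R]_n) : enorm (a *: x) = `|a| * enorm x.
Proof.
by rewrite /enorm dotvZl dotvZr mulrA -expr2 sqrtrM ?sqr_ge0// sqrtr_sqr.
Qed.

Lemma enormN n (x : 'cV[R]_n) : enorm (- x) = enorm x.
Proof. by rewrite -scaleN1r enormZ normrN1 mul1r. Qed.

Lemma enorm_distC n (x y : 'cV[R]_n) : enorm (x - y) = enorm (y - x).
Proof. by rewrite -enormN opprB. Qed.

Lemma dotv_le n (x y : 'cV[R]_n) : `|dotv x y| <= enorm x * enorm y.
Proof.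
rewrite -(@ler_pXn2r _ 2%N)// ?nnegrE ?mulr_ge0 ?enorm_ge0//.
rewrite exprMn !sqr_enorm real_normK ?num_real//.
have [->|x0] := eqVneq x 0; first by rewrite dotvC !dotv0r expr0n mul0r.
have xx : 0 < dotv x x.
  by rewrite -sqr_enorm exprn_gt0// lt_def enorm_ge0 enorm_eq0 x0.
(* Cauchy-Schwarz: this nonnegative square is [dotv x x] times the difference to be shown
   nonnegative. *)
have := dotvv_ge0 (dotv x x *: y - dotv x y *: x).
rewrite dotvBr !(dotvC (_ - _)) !dotvBr !dotvZl !dotvZr !(dotvC y x).
rewrite (_ : _ - _ = dotv x x * (dotv x x * dotv y y - dotv x y ^+ 2)).
  by rewrite pmulr_rge0// subr_ge0.
by ring.
Qed.

Lemma enormD n (x y : 'cV[R]_n) : enorm (x + y) <= enorm x + enorm y.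
Proof.
rewrite -(@ler_pXn2r _ 2%N)// ?nnegrE ?addr_ge0 ?enorm_ge0//.
rewrite sqrrD !sqr_enorm dotvDl !dotvDr (dotvC y x).
by have := le_trans (ler_norm _) (dotv_le x y); lra.
Qed.

Lemma ler_enormB n (x y : 'cV[R]_n) : enorm x - enorm y <= enorm (x - y).
Proof. by have := enormD (x - y) y; rewrite subrK; lra. Qed.

Lemma dotv_col (p : nat) (d : 'I_p -> nat) (x y : grouped R d) :
  dotv x y = \sum_(j < p) dotv (submxcol x j) (submxcol y j).
Proof.
rewrite /dotv -[x in LHS]submxcolK -[y in LHS]submxcolK tr_mxcol.
by rewrite mul_mxrow_mxcol summxE.
Qed.

Lemma enorm_submxcol (p : nat) (d : 'I_p -> nat) (x : grouped R d) j :
  enorm (submxcol x j) <= enorm x.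
Proof.
rewrite -(@ler_pXn2r _ 2%N)// ?nnegrE ?enorm_ge0// !sqr_enorm.
rewrite (dotv_col x) (bigD1 j)//= lerDl sumr_ge0// => i _.
exact: dotvv_ge0.
Qed.

(** The net is a cubic grid of mesh [c = e / (n + 1)]: rounding every coordinate down costs at most
    [n * c ^+ 2 <= e ^+ 2] in squared norm. The [+ 1] also covers dimension 0. Grid points may lie
    outside the ball. *)
Lemma enorm_net n (M e : R) : 0 < e ->
  exists s : seq 'cV[R]_n,
    forall u, enorm u <= M -> exists2 v, v \in s & enorm (u - v) <= e.
Proof.
move=> e0.
pose c := e / (n%:R + 1).
have n1 : 0 < n%:R + 1 :> R by rewrite ltr_wpDl.
have c0 : 0 < c by rewrite divr_gt0.
pose N := (Num.truncn (2 * M / c)).+1.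
pose grid (g : {ffun 'I_n -> 'I_N}) : 'cV[R]_n := \col_k ((g k)%:R * c - M).
exists (codom grid) => u uM.
have M0 : 0 <= M by exact: le_trans (enorm_ge0 _) uM.
have ukM k : `|u k ord0| <= M.
  apply: le_trans uM; rewrite -(@ler_pXn2r _ 2%N)// ?nnegrE ?enorm_ge0//.
  rewrite sqr_enorm dotvE (bigD1 k)//= real_normK ?num_real// expr2.
  by rewrite lerDl sumr_ge0// => i _; rewrite -expr2 sqr_ge0.
have uk0 k : 0 <= (u k ord0 + M) / c.
  by rewrite divr_ge0 ?(ltW c0)//; have := ukM k; rewrite ler_norml => /andP[]; lra.
pose g := [ffun k => inord (Num.truncn ((u k ord0 + M) / c)) : 'I_N].
have gE k : g k = Num.truncn ((u k ord0 + M) / c) :> nat.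
  rewrite ffunE inordK// ltnS; apply: le_truncn.
  by rewrite ler_pM2r ?invr_gt0//; have := ukM k; rewrite ler_norml => /andP[]; lra.
exists (grid g); first exact: codom_f.
have dk k : `|(u - grid g) k ord0| <= c.
  rewrite !mxE gE.
  have /andP[] := truncn_itv (uk0 k); set m := Num.truncn _.
  rewrite ler_pdivlMr// ltr_pdivrMr// -natr1 mulrDl mul1r => h1 h2.
  by rewrite ler_norml; apply/andP; split; lra.
rewrite -(@ler_pXn2r _ 2%N)// ?nnegrE ?enorm_ge0 ?(ltW e0)// sqr_enorm dotvE.
apply: le_trans (_ : \sum_(k < n) c ^+ 2 <= _).
  by apply: ler_sum => k _; rewrite -expr2 -real_normK ?num_real// ler_pXn2r ?nnegrE// ltW.
rewrite sumr_const card_ord -mulr_natl /c.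
have -> : e ^+ 2 = (n%:R + 1) ^+ 2 * (e / (n%:R + 1)) ^+ 2.
  by rewrite -exprMn mulrC divfK// gt_eqF.
rewrite ler_wpM2r ?sqr_ge0//.
have : 0 <= n%:R :> R by [].
by nra.
Qed.

(** No eigenvalue or compactness is involved. If [C] bounds the form of [B = invmx A], then
    nonnegativity of the form of [A] at [v - C^-1 *: (B *m v)] gives [2 * C^-1 * dotv v v <= dotv v
    (A *m v) + C^-2 * dotv v (B *m v)], and the last term is at most [C^-1 * dotv v v]. *)
Lemma pos_def_lower n (A : 'M[R]_n) : pos_def A ->
  exists2 c, 0 < c & forall v : 'cV[R]_n, c * dotv v v <= dotv v (A *m v).
Proof.
case=> symA posA.
have Au : A \in unitmx.
  (* A nonzero kernel row would be a vector on which the form of [A] vanishes. *)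
  rewrite -unitmx_tr -row_free_unit -kermx_eq0; apply/eqP/row_matrixP => i.
  rewrite row0; set w := row i _.
  have wA : w *m A^T = 0 by rewrite -row_mul mulmx_ker row0.
  apply/eqP; rewrite -trmx_eq0; apply/negPn/negP => /posA.
  have -> : A *m w^T = 0 by rewrite -[A]trmxK -trmx_mul wA trmx0.
  by rewrite dotv0r ltxx.
pose B := invmx A.
pose C := (\sum_i \sum_j `|B i j|) + 1.
have C0 : 0 < C by rewrite ltr_wpDl// sumr_ge0// => i _; rewrite sumr_ge0.
have BC (v : 'cV[R]_n) : dotv v (B *m v) <= C * dotv v v.
  rewrite dotvE /C mulrDl mul1r ler_wpDr ?dotvv_ge0// mulr_suml.
  apply: ler_sum => i _; rewrite mxE mulr_sumr mulr_suml.
  apply: ler_sum => j _.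
  apply: le_trans (ler_norm _) _; rewrite !normrM mulrCA ler_wpM2l//.
  have Hk k : v k ord0 ^+ 2 <= dotv v v.
    rewrite dotvE (bigD1 k)//= expr2 lerDl sumr_ge0// => l _.
    by rewrite -expr2 sqr_ge0.
  have := Hk i; have := Hk j; rewrite -(real_normK (num_real (v i _))).
  rewrite -(real_normK (num_real (v j _))).
  by have := sqr_ge0 (`|v i ord0| - `|v j ord0|); rewrite sqrrB; lra.
have posA' (v : 'cV[R]_n) : 0 <= dotv v (A *m v).
  have [->|/posA/ltW//] := eqVneq v 0; by rewrite mulmx0 dotv0r.
exists C^-1; first by rewrite invr_gt0.
move=> v.
have := posA' (v - C^-1 *: (B *m v)).
rewrite mulmxBr -scalemxAr (mulmxA A) mulmxV// mul1mx.
rewrite dotvBr !(dotvC (_ - _)) !dotvBr !dotvZl !dotvZr.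
have -> : dotv (A *m v) (B *m v) = dotv v v.
  by rewrite /dotv trmx_mul symA -mulmxA (mulmxA A) mulmxV// mul1mx.
rewrite (dotvC (A *m v)).
have := ler_wpM2l (sqr_ge0 C^-1) (BC v).
have -> : C^-1 ^+ 2 * (C * dotv v v) = C^-1 * dotv v v.
  by rewrite expr2 -!mulrA mulKf// gt_eqF.
lra.
Qed.

End euclidean.

(** * Knight's identity and the local loss *)

Section knight.
Context {R : realType}.
Implicit Types tau e h m : R.

(* Knight's identity: [check_fun tau (e - h) - check_fun tau e] is
   [- h * (tau - (e < 0))] plus this remainder. *)
Definition knight_rem tau e h : R :=
  check_fun tau (e - h) - check_fun tau e + h * (tau - (e < 0)%R%:R).

Lemma knight_remE tau e h : knight_rem tau e h =
  (if (0 <= e) && (e < h) then h - e else 0)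
  + (if (h <= e) && (e < 0) then e - h else 0).
Proof.
rewrite /knight_rem /check_fun subr_lt0.
by case: (ltP e h) => ?; case: (ltP e 0) => ? /=; try lra; rewrite ?addr0 ?add0r; ring.
Qed.

Lemma knight_rem_ge0 tau e h : 0 <= knight_rem tau e h.
Proof.
by rewrite knight_remE; case: (ltP e h) => ?; case: (ltP e 0) => ? /=; lra.
Qed.

(** An error between 0 and [h / 2] is still at distance at least [|h| / 2] from [h]; [min] and [max]
    treat both signs of [h] at once. *)
Lemma knight_rem_ge tau e h :
  Num.min 0 (h / 2) < e < Num.max 0 (h / 2) -> `|h| / 2 <= knight_rem tau e h.
Proof.
move=> /andP[]; rewrite gt_min lt_max knight_remE.
have [h0|h0] := leP 0 h.
  rewrite ger0_norm// => h1 h2; have e0 : 0 < e by case/orP: h1 => ?; lra.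
  have eh : e < h by case/orP: h2 => ?; lra.
  by rewrite (ltW e0) eh (leNgt h) eh /=; case/orP: h2 => ?; lra.
rewrite ltr0_norm// => h1 h2; have e0 : e < 0 by case/orP: h2 => ?; lra.
have eh : h < e by case/orP: h1 => ?; lra.
by rewrite (leNgt 0) e0 (ltW eh) /=; case/orP: h1 => ?; lra.
Qed.

(** In [h] the remainder has slopes 0 and 1 or -1, and it vanishes on [[-m, m]] as soon as
    [|e| > m]. The indicator keeps the sum of these slopes bounded in probability. *)
Lemma knight_rem_lip tau e h h' m : `|h| <= m -> `|h'| <= m ->
  `|knight_rem tau e h - knight_rem tau e h'| <= `|h - h'| * (`|e| <= m)%R%:R.
Proof.
move=> hm hm'; have := hm; have := hm'.
rewrite [`|h| <= _]ler_norml [`|h'| <= _]ler_norml => /andP[h3 h4] /andP[h1 h2].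
rewrite !knight_remE; have [_|em] := leP `|e| m.
  rewrite mulr1; have := ler_norm (h - h'); have := ler_norm (h' - h).
  rewrite (distrC h') ler_norml => ? ?; apply/andP.
  by case: (ltP e h) => ?; case: (ltP e h') => ?; case: (ltP e 0) => ? /=; lra.
have {}em : e < - m \/ m < e.
  by move: em; rewrite lter_normr => /orP[]; [right|left]; lra.
rewrite mulr0; case: (ltP e h) => ?; case: (ltP e h') => ?;
  case: (ltP e 0) => ? /=; rewrite ?addr0 ?subrr ?normr0//; case: em => ?; lra.
Qed.

(** Convexity: for these [tau] the check function is the maximum of the lines [tau * u] and
    [(tau - 1) * u]. *)
Lemma check_fun_ray tau e h s : 0 <= tau <= 1 -> 0 <= s <= 1 ->
  check_fun tau (e - s * h) <=
    (1 - s) * check_fun tau e + s * check_fun tau (e - h).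
Proof.
move=> /andP[t0 t1] /andP[s0 s1].
have lo u : tau * u <= check_fun tau u /\ (tau - 1) * u <= check_fun tau u.
  by rewrite /check_fun; case: (ltP u 0) => ? /=; split; nra.
have [l1 l2] := lo e; have [l3 l4] := lo (e - h).
have s1' : 0 <= 1 - s by lra.
rewrite {1}/check_fun; case: (ltP (e - s * h) 0) => _ /=.
  by have := ler_wpM2l s0 l4; have := ler_wpM2l s1' l2; lra.
by have := ler_wpM2l s0 l3; have := ler_wpM2l s1' l1; lra.
Qed.

End knight.

Section local_process.
Context {R : realType} {r : nat}.
Variables (tau : R) (n : nat) (X : nat -> 'cV[R]_r) (e : nat -> R).

Definition local_pred (i : nat) (u : 'cV[R]_r) : R :=
  dotv (X i) u / Num.sqrt n%:R.

Definition local_loss (u : 'cV[R]_r) : R :=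
  \sum_(i < n) (check_fun tau (e i - local_pred i u) - check_fun tau (e i)).

Definition local_score : 'cV[R]_r :=
  \sum_(i < n) ((tau - (e i < 0)%R%:R) / Num.sqrt n%:R) *: X i.

(** A random Lipschitz constant, on the ball of radius [M], for the sum of the Knight remainders. *)
Definition local_slope (M : R) : R :=
  \sum_(i < n) enorm (X i) / Num.sqrt n%:R
     * (`|e i| <= M * (enorm (X i) / Num.sqrt n%:R))%R%:R.

(** A lower bound for the sum of the Knight remainders at [u], obtained by keeping only the errors
    to which [knight_rem_ge] applies. *)
Definition local_curv (u : 'cV[R]_r) : R :=
  \sum_(i < n) `|local_pred i u| / 2
     * (Num.min 0 (local_pred i u / 2) < e i
          < Num.max 0 (local_pred i u / 2))%R%:R.

Lemma local_pred_le i u :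
  `|local_pred i u| <= enorm (X i) / Num.sqrt n%:R * enorm u.
Proof.
rewrite /local_pred normrM (ger0_norm (_ : 0 <= _^-1)) ?invr_ge0//.
by rewrite mulrAC ler_wpM2r ?invr_ge0// dotv_le.
Qed.

Lemma local_predB i u v : local_pred i (u - v) = local_pred i u - local_pred i v.
Proof. by rewrite /local_pred dotvBr mulrBl. Qed.

Lemma local_predZ i s u : local_pred i (s *: u) = s * local_pred i u.
Proof. by rewrite /local_pred dotvZr mulrA. Qed.

Lemma dotv_sum (I : finType) (F : I -> 'cV[R]_r) u :
  dotv (\sum_i F i) u = \sum_i dotv (F i) u.
Proof.
by apply: (big_morph (fun x => dotv x u)) => [x y|];
  rewrite ?dotvDl // dotvC dotv0r.
Qed.

Lemma local_lossE u : local_loss u =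
  \sum_(i < n) knight_rem tau (e i) (local_pred i u) - dotv local_score u.
Proof.
rewrite dotv_sum -sumrB; apply: eq_bigr => i _.
by rewrite /knight_rem dotvZl /local_pred; ring.
Qed.

Lemma local_loss0 : local_loss 0 = 0.
Proof.
by rewrite /local_loss big1// => i _; rewrite /local_pred dotv0r mul0r subr0 subrr.
Qed.

(** Cauchy-Schwarz bounds the score part; each remainder is bounded by [knight_rem_lip] at the level
    [M * a], which dominates the predictor on the ball. *)
Lemma local_loss_lip M u v : enorm u <= M -> enorm v <= M ->
  `|local_loss u - local_loss v| <=
    (enorm local_score + local_slope M) * enorm (u - v).
Proof.
move=> uM vM; rewrite !local_lossE.
rewrite (_ : _ - _ = - dotv local_score (u - v)
  + \sum_(i < n) (knight_rem tau (e i) (local_pred i u)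
                   - knight_rem tau (e i) (local_pred i v))); last first.
  by rewrite sumrB dotvBr; ring.
rewrite mulrDl; apply: le_trans (ler_normD _ _) _.
rewrite normrN lerD ?dotv_le//.
apply: le_trans (ler_norm_sum _ _ _) _; rewrite mulr_suml.
apply: ler_sum => i _.
set a := enorm (X i) / Num.sqrt n%:R.
have a0 : 0 <= a by rewrite divr_ge0// enorm_ge0.
have hM w : enorm w <= M -> `|local_pred i w| <= M * a.
  move=> wM; apply: le_trans (local_pred_le i w) _.
  by rewrite mulrC ler_wpM2r.
apply: le_trans (knight_rem_lip tau (e i) (hM u uM) (hM v vM)) _.
rewrite -local_predB mulrAC ler_wpM2r//.
exact: local_pred_le.
Qed.

Lemma local_loss_ge u :
  local_curv u - enorm local_score * enorm u <= local_loss u.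
Proof.
rewrite local_lossE; apply: lerB; last first.
  exact: le_trans (ler_norm _) (dotv_le _ _).
apply: ler_sum => i _; set h := local_pred i u.
have [he|] := boolP (_ < _ < _); first by rewrite mulr1 knight_rem_ge.
by rewrite mulr0 knight_rem_ge0.
Qed.

Hypothesis tau01 : 0 <= tau <= 1.

Lemma local_loss_ray s u : 0 <= s <= 1 -> local_loss (s *: u) <= s * local_loss u.
Proof.
move=> s01; rewrite /local_loss mulr_sumr; apply: ler_sum => i _.
rewrite local_predZ; have := check_fun_ray (e i) (local_pred i u) tau01 s01; lra.
Qed.

(** A point of the sphere of radius [M] has a net point [v] within [dl <= 1], so [enorm v] lies
    between [M - 1] and [M + 1]; this is why the slope is taken at [M + 1]. At [v] the loss is at
    least [c * (M - 1) ^+ 2 - 2 - K * (M + 1) >= 2], and returning to the sphere costs at most 1.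
    Convexity along rays carries the bound outwards. *)
Lemma local_loss_coercive (M K L c dl : R) (s : seq 'cV[R]_r) :
  1 < M -> 0 <= c -> 0 <= dl <= 1 -> enorm local_score <= K ->
  local_slope (M + 1) <= L -> (K + L) * dl <= 1 ->
  4 + K * (M + 1) <= c * (M - 1) ^+ 2 ->
  (forall u, enorm u <= M -> exists2 v, v \in s & enorm (u - v) <= dl) ->
  {in s, forall v, c * enorm v ^+ 2 - 2 <= local_curv v} ->
  forall u, M <= enorm u -> enorm u / M <= local_loss u.
Proof.
move=> M1 c0 /andP[dl0 dl1] hK hL hdl hM net curv.
have M0 : 0 < M by lra.
have sphere u : enorm u = M -> 1 <= local_loss u.
  move=> uM; have [|v vs uv] := net u; first by rewrite uM.
  have vM : enorm v <= M + 1.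
    by have := ler_enormB v u; rewrite enorm_distC; lra.
  have vM' : M - 1 <= enorm v by have := ler_enormB u v; lra.
  have uM1 : enorm u <= M + 1 by lra.
  have := local_loss_lip uM1 vM; rewrite ler_norml => /andP[lip _].
  have := local_loss_ge v; have := curv v vs.
  have H1 : (enorm local_score + local_slope (M + 1)) * enorm (u - v) <= 1.
    apply: le_trans hdl; apply: ler_pM => //; try exact: enorm_ge0; last by lra.
    rewrite addr_ge0 ?enorm_ge0// sumr_ge0// => i _.
    by rewrite mulr_ge0// divr_ge0 ?enorm_ge0.
  have H2 : enorm local_score * enorm v <= K * (M + 1).
    by apply: ler_pM => //; exact: enorm_ge0.
  have H3 : c * (M - 1) ^+ 2 <= c * enorm v ^+ 2.
    by rewrite ler_wpM2l// ler_pXn2r ?nnegrE//; lra.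
  lra.
(* With [s = M / enorm u] the point [s *: u] is on the sphere, so that [1 <= local_loss (s *: u) <=
   s * local_loss u]. *)
move=> u Mu; have u0 : 0 < enorm u by lra.
have s01 : 0 <= M / enorm u <= 1.
  by rewrite divr_ge0 ?(ltW M0) ?(ltW u0)//= ler_pdivrMr// mul1r.
have := local_loss_ray u s01.
have /sphere su : enorm ((M / enorm u) *: u) = M.
  by rewrite enormZ ger0_norm ?divfK ?gt_eqF//; case/andP: s01.
move=> /(le_trans su) H.
have uM0 : 0 <= enorm u / M by rewrite divr_ge0 ?(ltW M0) ?(ltW u0).
have := ler_wpM2l uM0 H; rewrite mulr1 mulrA mulrA divfK ?gt_eqF//.
by rewrite divff ?mul1r ?gt_eqF.
Qed.

End local_process.

(** * Selection off the exceptional set *)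

Section selection.
Context {R : realType}.
Variables (p : nat) (d : 'I_p -> nat) (tau gamma mu : R) (n : nat).
Variables (X : nat -> grouped R d) (e : nat -> R) (beta0 : grouped R d).
Hypothesis n_gt0 : (0 < n)%N.

Let y (i : nat) : R := dotv (X i) beta0 + e i.
Let sn : R := Num.sqrt n%:R.

Let sn0 : 0 < sn. Proof. by rewrite sqrtr_gt0 ltr0n. Qed.

(** Where a block of [bt] is 0 the weight here is 0 instead of [+oo]; this agrees with the extended
    penalty as long as that block of [b] is 0 too, which is the condition in [adaptive_loss_fin]. *)
Definition real_penalty (bt b : grouped R d) : R :=
  \sum_(j < p) enorm (submxcol bt j) `^ (- gamma) * enorm (submxcol b j).

Lemma adaptive_loss_fin bt b :
  (forall j, submxcol bt j = 0 -> submxcol b j = 0) ->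
  adaptive_loss tau gamma mu n X y bt b =
    (quantile_loss tau n X y b + mu * real_penalty bt b)%:E.
Proof.
move=> fin; rewrite /adaptive_loss EFinD EFinM; congr (_ + _ * _)%E.
  by congr _%:E; apply: eq_bigr => i _; rewrite -dotv_col.
rewrite -sumEFin; apply: eq_bigr => j _; rewrite /adaptive_weight enorm_eq0.
have [/fin ->|_] := eqVneq (submxcol bt j) 0; last by rewrite EFinM.
by rewrite enorm0 mule0 mulr0.
Qed.

Lemma adaptive_loss_lty bt b j : 0 < mu ->
  (adaptive_loss tau gamma mu n X y bt b < +oo)%E ->
  submxcol bt j = 0 -> submxcol b j = 0.
Proof.
move=> mu0 fin btj; apply/eqP; rewrite -enorm_eq0; apply/negP => /negP bj.
have w0 k : (0 <= adaptive_weight gamma (submxcol bt k) * (enorm (submxcol b k))%:E)%E.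
  rewrite mule_ge0// ?lee_fin ?enorm_ge0// /adaptive_weight.
  by case: ifP => _; rewrite ?leey// lee_fin powR_ge0.
have sumoo : (\sum_(k < p)
    adaptive_weight gamma (submxcol bt k) * (enorm (submxcol b k))%:E)%E = +oo%E.
  rewrite (bigD1 j)//=; set s := (\sum_(k < p | _) _)%E.
  have s0 : (0 <= s)%E by apply: sume_ge0 => k _; exact: w0.
  rewrite /adaptive_weight btj enorm0 eqxx.
  rewrite gt0_mulye ?lte_fin ?lt_def ?bj ?enorm_ge0// addye//.
  by rewrite gt_eqF// (lt_le_trans _ s0).
move: fin; rewrite /adaptive_loss sumoo gt0_muley ?lte_fin// addey//.
Qed.

Lemma quantile_loss_local b b' :
  quantile_loss tau n X y b - quantile_loss tau n X y b' =
  local_loss tau n X e (sn *: (b - beta0)) - local_loss tau n X e (sn *: (b' - beta0)).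
Proof.
rewrite /quantile_loss /local_loss -!sumrB; apply: eq_bigr => i _.
rewrite !local_predZ /local_pred !mulrA ![sn * _ / _]mulrAC divff ?gt_eqF// !mul1r.
by rewrite !dotvBr /y !opprB !addrA !(addrC (e i)) !(addrAC _ (e i)); ring.
Qed.

(** The deterministic core. Coercivity and the Lipschitz bound will hold off the exceptional set;
    [small_beta], [small_pen] and [big_pen] will hold for large [n]. *)
Lemma active_set_selection (M K : R) (bt bh : grouped R d) :
  0 < gamma -> 0 < mu -> 0 < M ->
  (forall u, M <= enorm u -> enorm u / M <= local_loss tau n X e u) ->
  (forall u v, enorm u <= M -> enorm v <= M ->
     `|local_loss tau n X e u - local_loss tau n X e v| <= K * enorm (u - v)) ->
  (forall j, submxcol beta0 j != 0 -> M / sn < enorm (submxcol beta0 j) / 2) ->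
  mu / sn * (\sum_(j < p) (enorm (submxcol beta0 j) / 2) `^ (- gamma)) * M < 1 ->
  K * sn < mu * (M / sn) `^ (- gamma) ->
  is_argmin (quantile_loss tau n X y) bt ->
  is_argmin (adaptive_loss tau gamma mu n X y bt) bh ->
  active_set bh = active_set beta0.
Proof.
move=> g0 mu0 M0 coer lip small_beta small_pen big_pen min_bt min_bh.
have local b : quantile_loss tau n X y b - quantile_loss tau n X y beta0 =
    local_loss tau n X e (sn *: (b - beta0)).
  by rewrite quantile_loss_local subrr scaler0 local_loss0 subr0.
have norm_scale b : enorm (sn *: (b - beta0)) = sn * enorm (b - beta0).
  by rewrite enormZ gtr0_norm.
have blk b j : enorm (submxcol b j - submxcol beta0 j) <= enorm (b - beta0).
  by rewrite -submxcolB enorm_submxcol.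
(* Farther away, coercivity would make the loss exceed its value at [beta0]. *)
have bt_close j : enorm (submxcol bt j - submxcol beta0 j) <= M / sn.
  apply: le_trans (blk _ _) _; rewrite ler_pdivlMr// mulrC -norm_scale leNgt.
  apply/negP => MU; have := coer _ (ltW MU).
  rewrite -local leNgt => /negP; apply; apply: le_lt_trans (_ : 0 < _).
    by rewrite subr_le0; exact: min_bt.
  by rewrite divr_gt0// (lt_trans M0).
have bt_large j : submxcol beta0 j != 0 ->
    enorm (submxcol beta0 j) / 2 <= enorm (submxcol bt j).
  move=> /small_beta; have := bt_close j.
  by have := ler_enormB (submxcol beta0 j) (submxcol bt j); rewrite enorm_distC; lra.
have b0_pos j : submxcol beta0 j != 0 -> 0 < enorm (submxcol beta0 j).
  by move=> b0; rewrite lt_def enorm_eq0 b0 enorm_ge0.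
(* The infinite weights sit on inactive blocks only, so the criterion is finite at [beta0], hence at
   its minimizer [bh]. *)
have fin0 j : submxcol bt j = 0 -> submxcol beta0 j = 0.
  move=> btj; apply/eqP/negPn/negP => b0.
  have := bt_large j b0; rewrite btj enorm0.
  by have := b0_pos j b0; lra.
have finh j : submxcol bt j = 0 -> submxcol bh j = 0.
  apply: adaptive_loss_lty mu0 _; apply: le_lt_trans (min_bh beta0) _.
  by rewrite adaptive_loss_fin// ltry.
have opt b : (forall j, submxcol bt j = 0 -> submxcol b j = 0) ->
    quantile_loss tau n X y bh + mu * real_penalty bt bh
      <= quantile_loss tau n X y b + mu * real_penalty bt b.
  by move=> finb; have := min_bh b; rewrite !adaptive_loss_fin.
set W := \sum_(j < p) _ in small_pen.
(* Inactive blocks contribute at most 0. On an active one [bt] keeps at least half the norm of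
   [beta0], which bounds the weight. *)
have pen_le : real_penalty bt beta0 - real_penalty bt bh <= W * enorm (bh - beta0).
  rewrite /real_penalty -sumrB mulr_suml; apply: ler_sum => j _.
  rewrite -mulrBr.
  have [b0|b0] := eqVneq (submxcol beta0 j) 0.
    rewrite b0 enorm0 sub0r mulrN (le_trans (_ : _ <= 0))//.
      by rewrite oppr_le0 mulr_ge0 ?powR_ge0 ?enorm_ge0.
    by rewrite mulr_ge0 ?powR_ge0 ?enorm_ge0.
  apply: le_trans (_ : enorm (submxcol bt j) `^ (- gamma) * enorm (bh - beta0) <= _).
    rewrite ler_wpM2l ?powR_ge0//; apply: le_trans (ler_enormB _ _) _.
    by rewrite enorm_distC blk.
  have b2 : 0 < enorm (submxcol beta0 j) / 2 by rewrite divr_gt0 ?b0_pos.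
  have bt0 := lt_le_trans b2 (bt_large j b0).
  rewrite ler_wpM2r ?enorm_ge0// !powRN lef_pV2 ?posrE ?powR_gt0//.
  by rewrite ge0_ler_powR ?nnegrE ?bt_large ?(ltW g0) ?(ltW b2) ?(ltW bt0).
(* With [D = enorm (bh - beta0)], leaving the ball would raise the loss by at least [sn * D / M] and
   save at most [mu * W * D] of penalty, less than that by [small_pen]. *)
have bh_close : sn * enorm (bh - beta0) < M.
  rewrite -norm_scale ltNge; apply/negP => MU.
  have := coer _ MU; have := opt beta0 fin0.
  rewrite -local norm_scale => H1 H2.
  have H3 : sn * enorm (bh - beta0) / M <= mu * (W * enorm (bh - beta0)).
    by have := ler_wpM2l (ltW mu0) pen_le; lra.
  have b0 : 0 < enorm (bh - beta0).
    by rewrite -(pmulr_rgt0 _ sn0) -norm_scale (lt_le_trans M0 MU).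
  move: H3; rewrite leNgt => /negP; apply.
  rewrite ltr_pdivlMr// -[ltRHS]mulr1.
  rewrite (_ : _ * M = sn * enorm (bh - beta0) * (mu / sn * W * M)).
    by rewrite ltr_pM2l// mulr_gt0.
  by field; rewrite gt_eqF.
apply/setP => j; rewrite !inE !enorm_eq0.
(* An active block estimated by 0 would have norm at most [M / sn], below half of itself. *)
have [b0|b0] := eqVneq (submxcol beta0 j) 0; last first.
  apply/negP => /eqP bhj.
  have := small_beta j b0; have := blk bh j; rewrite bhj sub0r enormN => H1.
  have : enorm (bh - beta0) <= M / sn.
    by rewrite ler_pdivlMr// mulrC ltW.
  by have := b0_pos j b0; lra.
apply/negPn/eqP; apply/eqP/negPn/negP => bhj.
have btj : submxcol bt j != 0 by apply: contra bhj => /eqP /finh ->.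
(* The competitor drops block [j]. As [beta0] vanishes there, this moves towards [beta0], so both
   points are in the ball where the Lipschitz bound holds. *)
pose b' : grouped R d := \mxcol_(i < p) (if i == j then 0 else submxcol bh i).
have b'E i : submxcol b' i = if i == j then 0 else submxcol bh i by rewrite mxcolK.
have bhE : quantile_loss tau n X y b' - quantile_loss tau n X y bh <=
    K * (sn * enorm (submxcol bh j)).
  have diff : enorm (b' - bh) = enorm (submxcol bh j).
    rewrite /enorm dotv_col (bigD1 j)//= [X in _ + X]big1 ?addr0 => [|i ij].
      by rewrite submxcolB b'E eqxx sub0r -!sqr_enorm enormN.
    by rewrite submxcolB b'E (negPf ij) subrr dotv0r.
  have b'_close : enorm (b' - beta0) <= enorm (bh - beta0).
    rewrite -(@ler_pXn2r _ 2%N)// ?nnegrE ?enorm_ge0// !sqr_enorm.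
    rewrite !(dotv_col (_ - beta0)); apply: ler_sum => i _.
    rewrite !submxcolB b'E; case: (eqVneq i j) => // ->.
    by rewrite b0 subrr dotv0r dotvv_ge0.
  rewrite quantile_loss_local; apply: le_trans (ler_norm _) _.
  apply: le_trans (lip _ _ _ _) _; rewrite ?norm_scale.
  - by apply: le_trans (ltW bh_close); rewrite ler_pM2l.
  - exact: ltW.
  - by rewrite -scalerBr opprB addrA subrK enormZ gtr0_norm// diff.
have penE : real_penalty bt bh - real_penalty bt b' =
    enorm (submxcol bt j) `^ (- gamma) * enorm (submxcol bh j).
  rewrite /real_penalty (bigD1 j)//= [X in _ - X](bigD1 j)//= b'E eqxx enorm0.
  rewrite mulr0 add0r [X in _ - X](eq_bigr (fun i => enorm (submxcol bt i)
      `^ (- gamma) * enorm (submxcol bh i))) ?addrK// => i ij.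
  by rewrite b'E (negPf ij).
have finb' i : submxcol bt i = 0 -> submxcol b' i = 0.
  by rewrite b'E; case: ifP => // _ /finh.
have bh0 : 0 < enorm (submxcol bh j) by rewrite lt_def enorm_eq0 bhj enorm_ge0.
have bt0 : 0 < enorm (submxcol bt j) by rewrite lt_def enorm_eq0 btj enorm_ge0.
(* On an inactive block [bt] has norm at most [M / sn], so its weight is large. *)
have weight : (M / sn) `^ (- gamma) <= enorm (submxcol bt j) `^ (- gamma).
  have := bt_close j; rewrite b0 subr0 => H.
  have Msn : 0 < M / sn by rewrite divr_gt0.
  rewrite !powRN lef_pV2 ?posrE ?powR_gt0//.
  by rewrite ge0_ler_powR ?nnegrE ?(ltW g0) ?(ltW bt0) ?(ltW Msn).
have := opt b' finb'; rewrite leNgt => /negP; apply.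
have := ler_wpM2l (ltW mu0) weight.
move: big_pen; rewrite -(ltr_pM2r bh0) => H1 H2.
have := ler_wpM2r (ltW bh0) H2.
have : mu * real_penalty bt bh - mu * real_penalty bt b' =
    mu * (enorm (submxcol bt j) `^ (- gamma) * enorm (submxcol bh j)).
  by rewrite -mulrBr penE.
lra.
Qed.

End selection.

(** * Probability of the exceptional set *)

Section error_probabilities.
Context {dT : measure_display} {T : measurableType dT} {R : realType}.
Variable P : probability T R.

Lemma indep_pair (Z : nat -> {RV P >-> R}) (S : nat -> set R) i k :
  independent_RVs Z -> (forall i, measurable (S i)) -> i != k ->
  P (Z i @^-1` S i `&` Z k @^-1` S k) =
    (P (Z i @^-1` S i) * P (Z k @^-1` S k))%E.
Proof.
move=> indZ mS ik; have := indZ [:: i; k] S; rewrite /= inE ik => /(_ isT mS).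
rewrite !big_cons big_nil mule1 => <-; congr (P _).
apply/seteqP; split => [t [ti tk] j /=|t tj].
  by rewrite !inE => /orP[] /eqP ->.
by split; apply: tj; rewrite /= !inE eqxx ?orbT.
Qed.

Lemma weighted_indic_dev (Z : nat -> {RV P >-> R}) (n : nat) (a : nat -> R)
    (S : nat -> set R) (l : R) :
  independent_RVs Z -> (forall i, measurable (S i)) -> 0 < l ->
  (P [set t | (l <= `|\sum_(i < n) a i *
        (\1_(Z i @^-1` S i) t - fine (P (Z i @^-1` S i)))|)%R]
   <= ((\sum_(i < n) a i ^+ 2 * fine (P (Z i @^-1` S i))) / l ^+ 2)%:E)%E.
Proof.
move=> indZ mS l0.
apply: (@chebyshev_indep_indic _ _ _ P n (fun i => Z i @^-1` S i) (fun i => a i)) => //.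
  by move=> i; exact: measurable_funPTI.
by move=> i k ik; apply: indep_pair.
Qed.

Lemma density_bounds (Z : {RV P >-> R}) (f : R -> R) (q Q w : R) (I : interval R) :
  has_density Z f -> 0 <= q -> 0 <= Q ->
  (forall x, x \in I -> q <= f x <= Q) ->
  lebesgue_measure [set` I] = w%:E ->
  q * w <= fine (P (Z @^-1` [set` I])) <= Q * w.
Proof.
case=> mf f0 fE q0 Q0 fI Iw.
have mI : measurable [set` I] by exact: measurable_itv.
have -> : P (Z @^-1` [set` I]) = (\int[lebesgue_measure]_(x in [set` I]) (f x)%:E)%E.
  by rewrite -fE.
have mfE : measurable_fun [set` I] (EFin \o f).
  by apply/measurable_EFinP; exact: measurable_funS mf.
have lo : ((q * w)%:E <= \int[lebesgue_measure]_(x in [set` I]) (f x)%:E)%E.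
  rewrite EFinM -Iw -integral_cst//; apply: ge0_le_integral => //.
  by move=> x Ix; rewrite lee_fin; case/andP: (fI _ Ix).
have hi : (\int[lebesgue_measure]_(x in [set` I]) (f x)%:E <= (Q * w)%:E)%E.
  rewrite EFinM -Iw -integral_cst//; apply: ge0_le_integral => //.
  - by move=> x _; rewrite lee_fin.
  - by move=> x Ix; rewrite lee_fin; case/andP: (fI _ Ix).
have fin : (\int[lebesgue_measure]_(x in [set` I]) (f x)%:E)%E \is a fin_num.
  by rewrite fin_numE -ltNye -ltey (lt_le_trans _ lo) ?ltNyr// (le_lt_trans hi) ?ltry.
by move: lo hi; rewrite -(fineK fin) !lee_fin => -> ->.
Qed.

Lemma density_near (f : R -> R) : {for 0, continuous f} -> 0 < f 0 ->
  exists2 e, 0 < e & forall x, `|x| < e -> f 0 / 2 <= f x <= 2 * f 0.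
Proof.
move=> cf f0.
have [e e0 He] : exists2 e, 0 < e & forall x, `|x| < e -> `|f 0 - f x| < f 0 / 2.
  move/cvgrPdist_lt: cf => /(_ (f 0 / 2)); rewrite divr_gt0// => /(_ isT).
  move=> /nbhs_ballP[e /= e0 He]; exists e => // x xe.
  by apply: He; rewrite /ball /= sub0r normrN.
by exists e => // x /He; rewrite ltr_norml => /andP[h1 h2]; apply/andP; split; lra.
Qed.

(** The check function tests strict negativity while the distribution function uses [<=]; a density
    leaves no atom at 0. *)
Lemma prob_lt0 (Z : {RV P >-> R}) (f F : R -> R) :
  has_density Z f -> (F 0)%:E = cdf Z 0 ->
  fine (P (Z @^-1` `]-oo, 0%R[)) = F 0.
Proof.
case=> mf f0 fE FE.
have Z0 : P (Z @^-1` [set 0%R]) = 0%E.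
  have -> : P (Z @^-1` [set 0%R]) = (\int[lebesgue_measure]_(x in [set 0%R]) (f x)%:E)%E.
    by rewrite -fE.
  by rewrite integral_set1.
have U0 : Z @^-1` `]-oo, 0%R] = Z @^-1` `]-oo, 0%R[ `|` Z @^-1` [set 0%R].
  apply/seteqP; split => t /=; rewrite !in_itv/=.
    by rewrite le_eqVlt => /orP[/eqP ->|]; [right|left].
  by move=> [/ltW//|->].
have PU : (P (Z @^-1` `]-oo, 0%R[ `|` Z @^-1` [set 0%R]) =
    P (Z @^-1` `]-oo, 0%R[) + P (Z @^-1` [set 0%R]))%E.
  apply: measureU; [exact: measurable_funPTI|exact: measurable_funPTI|].
  apply/seteqP; split => // t [] /=; rewrite in_itv/= => lt0 eq0.
  by move: lt0; rewrite eq0 ltxx.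
have -> : P (Z @^-1` `]-oo, 0%R[) = P (Z @^-1` `]-oo, 0%R]).
  by rewrite U0 PU Z0 adde0.
by rewrite (_ : P _ = cdf Z 0)// -FE.
Qed.

End error_probabilities.

(** * Limits of the design sums *)

Lemma cvg_sumr {R : realType} (I : Type) (s : seq I) (u : I -> nat -> R) (l : I -> R) :
  (forall i, u i n @[n --> \oo] --> l i) ->
  \sum_(i <- s) u i n @[n --> \oo] --> \sum_(i <- s) l i.
Proof.
by move=> ul; apply: (@cvg_big _ _ +%R 0 xpredT) => //; exact: add_continuous.
Qed.

Section design.
Context {R : realType} {r : nat}.
Variables (X : nat -> 'cV[R]_r) (Upsilon : 'M[R]_r).
Hypothesis A1 : design_assumption X Upsilon.

Lemma design_negligible (e : R) : 0 < e ->
  \forall n \near \oo, forall i, (i < n)%N -> enorm (X i) / Num.sqrt n%:R <= e.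
Proof.
move=> e0.
have /cvgr0_norm_le/(_ (e ^+ 2)) := design_max A1.
rewrite exprn_gt0// => /(_ isT); apply: filterS => n Hn i ni.
have n0 : 0 < n%:R :> R by rewrite ltr0n (leq_ltn_trans _ ni).
rewrite ler_pdivrMr ?sqrtr_gt0//.
rewrite -(@ler_pXn2r _ 2%N)// ?nnegrE ?enorm_ge0 ?mulr_ge0 ?(ltW e0)//.
rewrite exprMn sqr_enorm sqr_sqrtr ?(ltW n0)// -ler_pdivrMr// mulrC.
apply: le_trans (le_trans (ler_norm _) Hn).
rewrite ler_pM2l ?invr_gt0//.
exact: (@le_bigmax_cond _ _ _ 0 (Ordinal ni) xpredT (fun i : 'I_n => dotv (X i) (X i))).
Qed.

(** The sum is the quadratic form at [v] of the normalized Gram matrix, which converges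
    entrywise. *)
Lemma design_quadratic (v : 'cV[R]_r) :
  \sum_(i < n) local_pred n X i v ^+ 2 @[n --> \oo] --> dotv v (Upsilon *m v).
Proof.
have -> : (fun n => \sum_(i < n) local_pred n X i v ^+ 2) =
    (fun n => \sum_k \sum_l v k ord0 *
       ((n%:R^-1 *: \sum_(i < n) (X i *m (X i)^T)) k l * v l ord0)).
  apply/funext => n.
  transitivity (dotv v ((n%:R^-1 *: \sum_(i < n) (X i *m (X i)^T)) *m v)).
    rewrite -scalemxAl dotvZr mulmx_suml dotvC dotv_sum mulr_sumr.
    apply: eq_bigr => i _; rewrite /local_pred expr_div_n sqr_sqrtr// mulrC.
    congr (_ * _); rewrite -mulmxA.
    have -> : (X i)^T *m v = (dotv (X i) v)%:M by rewrite -mx11_scalar.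
    by rewrite mul_mx_scalar dotvZl expr2.
  by rewrite dotvE; apply: eq_bigr => k _; rewrite mxE mulr_sumr.
rewrite dotvE; under [X in _ --> X]eq_bigr do rewrite mxE mulr_sumr.
apply: cvg_sumr => k; apply: cvg_sumr => l.
apply: cvgMl_tmp; apply: cvgMr_tmp.
exact: cvg_comp (design_gram A1) (@coord_continuous _ _ _ k l Upsilon).
Qed.

Lemma design_bounded : exists2 C, 0 < C &
  \forall n \near \oo, \sum_(i < n) (enorm (X i) / Num.sqrt n%:R) ^+ 2 <= C.
Proof.
(* The limit is the trace of [Upsilon], written as its quadratic form summed over the standard
   basis. *)
have cv : \sum_(i < n) (enorm (X i) / Num.sqrt n%:R) ^+ 2 @[n --> \oo] -->
    \sum_(k < r) dotv (delta_mx k ord0) (Upsilon *m delta_mx k ord0).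
  have -> : (fun n => \sum_(i < n) (enorm (X i) / Num.sqrt n%:R) ^+ 2) =
     (fun n => \sum_(k < r) \sum_(i < n) local_pred n X i (delta_mx k ord0) ^+ 2).
    apply/funext => n; rewrite exchange_big; apply: eq_bigr => i _ /=.
    rewrite expr_div_n sqr_enorm dotvE mulr_suml; apply: eq_bigr => k _.
    rewrite /local_pred expr_div_n; congr (_ / _).
    rewrite dotvE (bigD1 k)//= big1 ?addr0 => [|l lk].
      by rewrite mxE !eqxx mulr1 expr2.
    by rewrite mxE (negPf lk) mulr0.
  by apply: cvg_sumr => k; exact: design_quadratic.
set l := \sum_(k < r) _ in cv.
exists (`|l| + 1); first by rewrite ltr_wpDl.
apply: cvgr_le cv _ _; rewrite (le_lt_trans (ler_norm _))// ltrDl//.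
Qed.

End design.

(** * Outer probability bounds *)

Section outer_probability.
Context {dT : measure_display} {T : measurableType dT} {R : realType}.
Variable P : probability T R.

(* The exceptional sets below need not be shown measurable themselves. *)
Definition outer_prob_le (S : set T) (x : R) : Prop :=
  exists B, [/\ measurable B, S `<=` B & (P B <= x%:E)%E].

Lemma outer_prob_leS (S S' : set T) (x : R) :
  S `<=` S' -> outer_prob_le S' x -> outer_prob_le S x.
Proof. by move=> SS' [B [mB S'B PB]]; exists B; split => // t /SS'/S'B. Qed.

Lemma outer_prob_le_trans (S : set T) (x y : R) :
  x <= y -> outer_prob_le S x -> outer_prob_le S y.
Proof.
by move=> xy [A [mA SA PA]]; exists A; split => //; rewrite (le_trans PA)// lee_fin.
Qed.

Lemma outer_prob_leU (S S' : set T) (x y : R) :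
  outer_prob_le S x -> outer_prob_le S' y -> outer_prob_le (S `|` S') (x + y).
Proof.
move=> [B [mB SB PB]] [B' [mB' SB' PB']]; exists (B `|` B'); split.
- exact: measurableU.
- by move=> t [/SB|/SB']; [left|right].
- by rewrite (le_trans (measureU2 P mB mB'))// EFinD leeD.
Qed.

Lemma outer_prob_le_bigcup (I : eqType) (s : seq I) (S : I -> set T) (x : R) :
  {in s, forall i, outer_prob_le (S i) x} ->
  outer_prob_le [set t | exists2 i, i \in s & S i t] ((size s)%:R * x).
Proof.
elim: s => [_|i s IH Sx].
  by exists set0; split => //= [t []//|]; rewrite measure0 mul0r.
rewrite /= -natr1 mulrDl mul1r addrC.
apply: (@outer_prob_leS _ (S i `|` [set t | exists2 i, i \in s & S i t])).
  move=> t [j]; rewrite inE => /orP[/eqP ->|js Sj]; first by left.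
  by right; exists j.
apply: outer_prob_leU; first by apply: Sx; rewrite mem_head.
by apply: IH => j js; apply: Sx; rewrite inE js orbT.
Qed.

Lemma outer_prob_le_setC (S : set T) (x : R) : measurable S ->
  outer_prob_le (~` S) x -> 1 - x <= fine (P S).
Proof.
move=> mS [B [mB SB PB]].
have : (P (~` S) <= x%:E)%E.
  by apply: le_trans PB; rewrite le_measure ?inE//; exact: measurableC.
rewrite probability_setC// -(fineK (fin_num_measure P _ mS)) -EFinB lee_fin.
by lra.
Qed.

End outer_probability.

(** * Stochastic bounds on score, slope and curvature *)

Lemma lebesgue_measure_itv_cc {R : realType} (a b : R) : a <= b ->
  lebesgue_measure `[a, b] = (b - a)%:E.
Proof.
rewrite lebesgue_measure_itv/= lte_fin le_eqVlt => /orP[/eqP ->|->//].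
by rewrite ltxx subrr.
Qed.

Lemma lebesgue_measure_itv_oo {R : realType} (a b : R) : a <= b ->
  lebesgue_measure `]a, b[ = (b - a)%:E.
Proof.
rewrite lebesgue_measure_itv/= lte_fin le_eqVlt => /orP[/eqP ->|->//].
by rewrite ltxx subrr.
Qed.

Lemma near_in_seq (I : eqType) (s : seq I) (Q : I -> nat -> Prop) :
  {in s, forall i, \forall n \near \oo, Q i n} ->
  \forall n \near \oo, {in s, forall i, Q i n}.
Proof.
elim: s => [_|i s IH Qs]; first by apply: nearW => n i; rewrite in_nil.
have Qi : \forall n \near \oo, Q i n by apply: Qs; rewrite mem_head.
have {IH}/IH Qs' : {in s, forall i, \forall n \near \oo, Q i n}.
  by move=> j js; apply: Qs; rewrite inE js orbT.
near=> n => j; rewrite inE => /orP[/eqP ->|]; first by near: n.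
by move: j; near: n.
Unshelve. all: by end_near. Qed.

Lemma minmax_itv {R : realType} (h x : R) :
  (Num.max 0 h - Num.min 0 h = `|h|) /\ (Num.min 0 h < x < Num.max 0 h -> `|x| < `|h|).
Proof.
have [h0|h0] := leP 0 h; [rewrite ger0_norm//|rewrite ltr0_norm//].
  split; first lra.
  by move=> /andP[? ?]; rewrite ger0_norm; lra.
split; first lra.
by move=> /andP[? ?]; rewrite ler0_norm; lra.
Qed.

Section local_process_probability.
Context {dT : measure_display} {T : measurableType dT} {R : realType}.
Variables (P : probability T R) (r : nat) (X : nat -> 'cV[R]_r).
Variables (Upsilon : 'M[R]_r) (tau : R) (eps : nat -> {RV P >-> R}).
Variables (B : set R) (F f : R -> R).
Hypothesis A1 : design_assumption X Upsilon.
Hypothesis A2 : error_assumption X Upsilon tau eps B F f.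

Let prob i (S : set R) : R := fine (P (eps i @^-1` S)).

(** Near 0 the density lies between [f 0 / 2] and [2 * f 0], so the probability of a short interval
    there is comparable to its length, uniformly in [i]. *)
Lemma error_itv_prob : exists q Q dl, [/\ 0 < q, 0 < Q, 0 < dl &
  forall i (I : interval R) w, lebesgue_measure [set` I] = w%:E ->
    (forall x, x \in I -> `|x| < dl) -> q * w <= prob i [set` I] <= Q * w].
Proof.
have [cf f0] := nbhs_singleton (error_density0 A2).
have [dl dl0 fdl] := density_near cf f0.
exists (f 0 / 2), (2 * f 0), dl; split; rewrite ?divr_gt0 ?mulr_gt0//.
move=> i I w Iw Idl; apply: density_bounds (error_density A2 i) _ _ _ Iw.
- by rewrite divr_ge0// ltW.
- by rewrite mulr_ge0// ltW.
- by move=> x /Idl/fdl.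
Qed.

Lemma indic_preimage i (I : interval R) t :
  \1_(eps i @^-1` [set` I]) t = (eps i t \in I)%:R :> R.
Proof.
rewrite indicE; suff -> : (t \in eps i @^-1` [set` I]) = (eps i t \in I) by [].
by apply/idP/idP => [|It]; rewrite inE.
Qed.

Lemma weighted_indic_dev_outer n (a : nat -> R) (S : nat -> set R) (l : R) :
  (forall i, measurable (S i)) -> 0 < l ->
  outer_prob_le P
    [set t | l <= `|\sum_(i < n) a i * (\1_(eps i @^-1` S i) t - prob i (S i))|]
    ((\sum_(i < n) a i ^+ 2 * prob i (S i)) / l ^+ 2).
Proof.
move=> mS l0.
pose Z t := \sum_(i < n) a i * (\1_(eps i @^-1` S i) t - prob i (S i)).
exists [set t | l <= `|Z t|]; split => //; last first.
  exact: weighted_indic_dev (error_indep A2) mS l0.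
have mZ : measurable_fun setT Z.
  apply: measurable_sum => i; apply: measurable_funM => //.
  apply: measurable_funB => //; apply: measurable_indic.
  exact: measurable_funPTI.
rewrite (_ : [set t | _] = setT `&` (Num.norm \o Z) @^-1` `[l, +oo[).
  by apply: measurableT_comp mZ _ _ _ => //; exact: measurable_itv.
by rewrite setTI; apply/seteqP; split => t /=; rewrite in_itv/= andbT.
Qed.

(** Chebyshev at level 1: once every probability is at most [x / C], the variance is at most
    [C * (x / C) = x]. *)
Lemma weighted_indic_concentrates (a : nat -> nat -> R)
    (S : nat -> nat -> set R) (C : R) : 0 < C ->
  (forall n i, measurable (S n i)) ->
  (\forall n \near \oo, \sum_(i < n) a n i ^+ 2 <= C) ->
  (forall e, 0 < e -> \forall n \near \oo, forall i, (i < n)%N -> prob i (S n i) <= e) ->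
  forall x, 0 < x -> \forall n \near \oo, outer_prob_le P
    [set t | 1 < `|\sum_(i < n) a n i *
       (\1_(eps i @^-1` S n i) t - prob i (S n i))|] x.
Proof.
move=> C0 mS aC small x x0.
have := small (x / C); rewrite divr_gt0// => /(_ isT) smallx.
near=> n.
have aCn : \sum_(i < n) a n i ^+ 2 <= C by near: n.
have Sn : forall i, (i < n)%N -> prob i (S n i) <= x / C by near: n.
apply: (@outer_prob_leS _ _ _ _ _ _ _ (fun t => @ltW _ _ _ _)).
apply: outer_prob_le_trans (weighted_indic_dev_outer n (a n) (mS n) ltr01).
rewrite expr1n divr1.
apply: le_trans (_ : \sum_(i < n) a n i ^+ 2 * (x / C) <= _).
  by apply: ler_sum => i _; rewrite ler_wpM2l ?sqr_ge0// Sn.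
by rewrite -mulr_suml mulrA ler_pdivrMr// mulrC ler_pM2l.
Unshelve. all: by end_near. Qed.

(** With [a = enorm (X i) / sqrt n], the window [[- M a, M a]] has probability at most [2 Q M a], so
    the mean is at most [2 Q M C]; the fluctuation adds at most 1. The constant [L] does not depend
    on [x]. *)
Lemma local_slope_tight (M : R) : 0 < M -> exists2 L, 0 < L &
  forall x, 0 < x -> \forall n \near \oo,
    outer_prob_le P [set t | L < local_slope n X (fun i => eps i t) M] x.
Proof.
move=> M0; have [q [Q [dl [q0 Q0 dl0 probI]]]] := error_itv_prob.
have [C C0 aC] := design_bounded A1.
pose a n i := enorm (X i) / Num.sqrt n%:R.
have a0 n i : 0 <= a n i by rewrite divr_ge0 ?enorm_ge0.
pose I n i := `[- (M * a n i), M * a n i].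
have probS n i : M * a n i < dl -> prob i [set` I n i] <= Q * (2 * M * a n i).
  move=> Mdl; have Ma0 : 0 <= M * a n i by rewrite mulr_ge0// ltW.
  have [|x|_ +] := andP (probI i (I n i) (2 * M * a n i) _ _); last by [].
  - by rewrite lebesgue_measure_itv_cc; [congr _%:E; lra|lra].
  - by rewrite in_itv/= -ler_norml => /le_lt_trans; apply.
have Mdl : \forall n \near \oo, forall i, (i < n)%N -> M * a n i < dl.
  have := design_negligible A1 (_ : 0 < dl / (2 * M)).
  rewrite divr_gt0 ?mulr_gt0// => /(_ isT); apply: filterS => n Hn i /Hn.
  by rewrite -/(a n i) ler_pdivlMr ?mulr_gt0//; lra.
exists (2 * Q * M * C + 1); first by rewrite ltr_wpDl// !mulr_ge0// ltW.
move=> x x0.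
have small e : 0 < e ->
    \forall n \near \oo, forall i, (i < n)%N -> prob i [set` I n i] <= e.
  move=> e0; have eQ : 0 < e / (2 * Q * M) by rewrite divr_gt0 ?mulr_gt0.
  near=> n => i ni; apply: le_trans (probS n i _) _.
    by move: i ni; near: n.
  have : a n i <= e / (2 * Q * M) by move: i ni; near: n; exact: design_negligible A1 _ eQ.
  by rewrite ler_pdivlMr ?mulr_gt0//; lra.
have mI n i : measurable [set` I n i] by exact: measurable_itv.
have dev := weighted_indic_concentrates (a := a) C0 mI aC small x0.
near=> n.
have devn : outer_prob_le P [set t | 1 < `|\sum_(i < n) a n i *
    (\1_(eps i @^-1` [set` I n i]) t - prob i [set` I n i])|] x by near: n.
apply: outer_prob_leS devn => t /=; apply: contraTT; rewrite -!leNgt => dev1.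
have aCn : \sum_(i < n) a n i ^+ 2 <= C by near: n.
have Mn : forall i, (i < n)%N -> M * a n i < dl by near: n.
have mean : \sum_(i < n) a n i * prob i [set` I n i] <= 2 * Q * M * C.
  apply: le_trans (_ : \sum_(i < n) 2 * Q * M * a n i ^+ 2 <= _).
    apply: ler_sum => i _; have := ler_wpM2l (a0 n i) (probS n i (Mn i (ltn_ord i))).
    by rewrite expr2; lra.
  by rewrite -mulr_sumr ler_pM2l// !mulr_gt0.
have slopeE : local_slope n X (fun i => eps i t) M =
    \sum_(i < n) a n i * \1_(eps i @^-1` [set` I n i]) t.
  by apply: eq_bigr => i _; rewrite indic_preimage in_itv/= -ler_norml.
rewrite slopeE; move: dev1; rewrite ler_norml => /andP[_].
under eq_bigr do rewrite mulrBr.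
by rewrite sumrB; lra.
Unshelve. all: by end_near. Qed.

(** The mean is at least [q] times the sum of the squared half predictors, which tends to a quarter
    of the form of [Upsilon] at [v]; hence [c = q * l / 4]. Having [c] independent of [v] and [x]
    allows the radius, and then the net, to be chosen after it. *)
Lemma local_curv_large : exists2 c, 0 < c &
  forall v x, 0 < x -> \forall n \near \oo, outer_prob_le P
    [set t | local_curv n X (fun i => eps i t) v < c * enorm v ^+ 2 - 2] x.
Proof.
have [q [Q [dl [q0 Q0 dl0 probI]]]] := error_itv_prob.
have [l l0 lower] := pos_def_lower (design_pos_def A1).
exists (q * l / 4); first by rewrite divr_gt0 ?mulr_gt0.
move=> v x x0.
pose h n i := local_pred n X i v / 2.
pose a n i : R := `|h n i|.
have aE n i : a n i = `|local_pred n X i v| / 2.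
  by rewrite /a /h (normrM (local_pred n X i v)) normfV normr_nat.
pose I n i := `]Num.min 0 (h n i), Num.max 0 (h n i)[.
have mI n i : measurable [set` I n i] by exact: measurable_itv.
have Ilen n i : lebesgue_measure [set` I n i] = (a n i)%:E.
  by rewrite lebesgue_measure_itv_oo ?(minmax_itv _ 0).1// ge_min le_max lexx.
have probS n i : a n i <= dl -> q * a n i <= prob i [set` I n i] <= Q * a n i.
  move=> adl; apply: probI => // y; rewrite in_itv/= => /(minmax_itv _ _).2.
  by move=> /lt_le_trans; apply.
have quad := @design_quadratic _ _ _ _ A1 v.
set s := dotv v (Upsilon *m v) in quad.
have s0 : 0 <= s by apply: le_trans (lower v); rewrite mulr_ge0 ?dotvv_ge0 ?ltW.
have a2 n : \sum_(i < n) a n i ^+ 2 = (\sum_(i < n) local_pred n X i v ^+ 2) / 4.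
  rewrite mulr_suml; apply: eq_bigr => i _.
  by rewrite /a real_normK ?num_real// /h; field.
have aC : \forall n \near \oo, \sum_(i < n) a n i ^+ 2 <= s / 4 + 1.
  have : \forall n \near \oo, \sum_(i < n) local_pred n X i v ^+ 2 <= s + 4.
    by move/cvgr_le: quad; apply; rewrite ltrDl.
  by apply: filterS => n Hn; rewrite a2; lra.
(* After multiplication by [q] this tolerance costs 1; the deviation from the mean costs another 1,
   whence the 2 in the statement. *)
have aclow : \forall n \near \oo, s / 4 - q^-1 <= \sum_(i < n) a n i ^+ 2.
  have : \forall n \near \oo, s - 4 / q <= \sum_(i < n) local_pred n X i v ^+ 2.
    by move/cvgr_ge: quad; apply; rewrite gtrBl divr_gt0.
  by apply: filterS => n Hn; rewrite a2; lra.
have asmall e : 0 < e -> \forall n \near \oo, forall i, (i < n)%N -> a n i <= e.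
  (* The [+ 1] covers [v = 0]. *)
  move=> e0; have ev : 0 < e / (enorm v + 1) by rewrite divr_gt0// ltr_wpDl ?enorm_ge0.
  apply: filterS (design_negligible A1 ev) => n Hn i /Hn.
  rewrite ler_pdivlMr ?ltr_wpDl ?enorm_ge0// => Hi.
  have := local_pred_le n X i v; rewrite aE.
  have : 0 <= enorm (X i) / Num.sqrt n%:R by rewrite divr_ge0 ?enorm_ge0.
  by have := normr_ge0 (local_pred n X i v); lra.
have small e : 0 < e ->
    \forall n \near \oo, forall i, (i < n)%N -> prob i [set` I n i] <= e.
  move=> e0; have eQ : 0 < e / Q by rewrite divr_gt0.
  near=> n => i ni.
  have adl : a n i <= dl by move: i ni; near: n; exact: asmall.
  have aeQ : a n i <= e / Q by move: {adl} i ni; near: n; exact: asmall.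
  have /andP[_] := probS n i adl; move: aeQ; rewrite ler_pdivlMr//; lra.
have s4 : 0 < s / 4 + 1 by lra.
have dev := weighted_indic_concentrates (a := a) s4 mI aC small x0.
near=> n.
have devn : outer_prob_le P [set t | 1 < `|\sum_(i < n) a n i *
    (\1_(eps i @^-1` [set` I n i]) t - prob i [set` I n i])|] x by near: n.
apply: outer_prob_leS devn => t /=; apply: contraTT; rewrite -!leNgt => dev1.
have adl : forall i, (i < n)%N -> a n i <= dl by near: n; exact: asmall.
have an : s / 4 - q^-1 <= \sum_(i < n) a n i ^+ 2 by near: n.
have mean : q * s / 4 - 1 <= \sum_(i < n) a n i * prob i [set` I n i].
  apply: le_trans (_ : \sum_(i < n) q * a n i ^+ 2 <= _).
    rewrite -mulr_sumr; have := ler_wpM2l (ltW q0) an.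
    by rewrite mulrBr divff ?gt_eqF//; lra.
  apply: ler_sum => i _; rewrite expr2 mulrCA ler_wpM2l ?normr_ge0//.
  by case/andP: (probS n i (adl i (ltn_ord i))).
have curvE : local_curv n X (fun i => eps i t) v =
    \sum_(i < n) a n i * \1_(eps i @^-1` [set` I n i]) t.
  by apply: eq_bigr => i _; rewrite indic_preimage in_itv/= aE.
have := ler_wpM2l (ltW q0) (lower v); rewrite -/s sqr_enorm.
rewrite curvE; move: dev1; rewrite ler_norml => /andP[+ _].
under eq_bigr do rewrite mulrBr.
by rewrite sumrB; lra.
Unshelve. all: by end_near. Qed.

(** Up to sign, each coordinate is a weighted sum of the indicators of negative errors, centred
    because their mean is [tau]. Chebyshev is applied to each of the [r] coordinates. *)
Lemma local_score_tight x : 0 < x -> exists2 K, 0 < K &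
  \forall n \near \oo, outer_prob_le P
    [set t | K < enorm (local_score tau n X (fun i => eps i t))] x.
Proof.
move=> x0; have [C C0 aC] := design_bounded A1.
have xC0 : 0 <= r%:R * C / x by rewrite divr_ge0 ?mulr_ge0 ?(ltW C0) ?(ltW x0).
(* Chosen so that [r * C = x * (l - 1) <= x * l ^+ 2], which makes the union bound
   [r * (C / l ^+ 2)] at most [x]. *)
set l := r%:R * C / x + 1; have l1 : 1 <= l by rewrite lerDr.
have l0 : 0 < l by exact: lt_le_trans ltr01 l1.
have r1 : 0 < r%:R + 1 :> R by rewrite ltr_wpDl.
exists ((r%:R + 1) * l); first exact: mulr_gt0.
near=> n.
have aCn : \sum_(i < n) (enorm (X i) / Num.sqrt n%:R) ^+ 2 <= C by near: n.
pose W t := local_score tau n X (fun i => eps i t).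
have coord (k : 'I_r) : outer_prob_le P [set t | l <= `|W t k ord0|] (C / l ^+ 2).
  pose a i := X i k ord0 / Num.sqrt n%:R.
  have tauE i : prob i `]-oo, 0%R[ = tau.
    by rewrite (error_quantile A2) /prob (prob_lt0 (error_density A2 i) (error_cdf A2 i 0)).
  have WE t : `|W t k ord0| = `|\sum_(i < n) a i *
      (\1_(eps i @^-1` `]-oo, 0%R[) t - prob i `]-oo, 0%R[)|.
    rewrite -[RHS]normrN -sumrN summxE; congr `|_|; apply: eq_bigr => i _.
    by rewrite mxE indic_preimage in_itv/= tauE /a; ring.
  have mS (i : nat) : measurable (`]-oo, (0 : R)[%classic : set R) by exact: measurable_itv.
  apply: outer_prob_leS (outer_prob_le_trans _ (weighted_indic_dev_outer n a mS l0)).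
    by move=> t /=; rewrite WE.
  rewrite ler_wpM2r ?invr_ge0 ?sqr_ge0//; apply: le_trans aCn.
  apply: ler_sum => i _; rewrite /a !expr_div_n mulrAC ler_wpM2r ?invr_ge0 ?sqr_ge0//.
  rewrite sqr_enorm dotvE (bigD1 k)//= -expr2.
  apply: le_trans (_ : X i k ord0 ^+ 2 * 1 <= _).
    have mA : measurable (eps i @^-1` `]-oo, 0%R[) by exact: measurable_funPTI.
    have := probability_le1 P mA.
    rewrite -(fineK (fin_num_measure P _ mA)) lee_fin => p1.
    by rewrite ler_wpM2l ?sqr_ge0.
  by rewrite mulr1 lerDl sumr_ge0// => j _; rewrite -expr2 sqr_ge0.
have := @outer_prob_le_bigcup _ _ _ P _ (enum 'I_r) _ _ (fun k _ => coord k).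
rewrite -cardE card_ord => bad.
apply: outer_prob_leS (outer_prob_le_trans _ bad).
  move=> t /=; apply: contraPP => small; apply/negP; rewrite -leNgt.
  have Wl k : `|W t k ord0| <= l.
    rewrite leNgt; apply/negP => lW; apply: small; exists k; last exact: ltW.
    by rewrite mem_enum.
  rewrite -(@ler_pXn2r _ 2%N)// ?nnegrE ?enorm_ge0 ?mulr_ge0 ?(ltW l0) ?(ltW r1)//.
  rewrite sqr_enorm dotvE; apply: le_trans (_ : \sum_(k < r) l ^+ 2 <= _).
    apply: ler_sum => k _; rewrite -expr2 -real_normK ?num_real//.
    by rewrite ler_pXn2r ?nnegrE// ltW.
  rewrite sumr_const card_ord -[l ^+ 2 *+ r]mulr_natl exprMn ler_wpM2r ?sqr_ge0//.
  have : 0 <= r%:R :> R by [].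
  by nra.
rewrite mulrA ler_pdivrMr ?exprn_gt0//.
have : r%:R * C = x * (l - 1) by rewrite /l; field; rewrite gt_eqF.
move=> ->; rewrite ler_pM2l// expr2; nra.
Unshelve. all: by end_near. Qed.

End local_process_probability.

(** * Measurability of the selection event and conclusion *)

Lemma measurable_active_set {R : realType} {dT : measure_display}
    {T : measurableType dT} (p : nat) (d : 'I_p -> nat) (b : T -> grouped R d)
    (A : {set 'I_p}) :
  random_vector b -> measurable [set t | active_set (b t) = A].
Proof.
move=> mb.
have -> : [set t | active_set (b t) = A] =
    \bigcap_(j in [set: 'I_p]) [set t | (submxcol (b t) j != 0) = (j \in A)].
  apply/seteqP; split => t /= bA.
    by move=> j _ /=; rewrite -bA inE enorm_eq0.
  by apply/setP => j; rewrite inE enorm_eq0; exact: bA.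
apply: fin_bigcap_measurable => // j _.
have mZ : measurable [set t | submxcol (b t) j = 0].
  have -> : [set t | submxcol (b t) j = 0] =
      setT `&` (fun t => dotv (submxcol (b t) j) (submxcol (b t) j)) @^-1` [set 0].
    rewrite setTI; apply/seteqP; split => t /=; first by move=> ->; rewrite dotv0r.
    by rewrite -sqr_enorm => /eqP; rewrite sqrf_eq0 enorm_eq0 => /eqP.
  have mf : measurable_fun setT (fun t => dotv (submxcol (b t) j) (submxcol (b t) j)).
    under eq_fun do rewrite dotvE.
    apply: measurable_sum => k.
    have mk : measurable_fun setT (fun t => submxcol (b t) j k ord0).
      by under eq_fun do rewrite mxE; exact: mb.
    exact: measurable_funM.
  by apply: mf => //; exact: measurable_set1.
have [jA|jA] := boolP (j \in A).
  rewrite (_ : [set t | _] = ~` [set t | submxcol (b t) j = 0]).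
    exact: measurableC.
  by apply/seteqP; split => t /= /eqP.
rewrite (_ : [set t | _] = [set t | submxcol (b t) j = 0])//.
by apply/seteqP; split => t /=; [move/negbFE/eqP|move=> ->; rewrite eqxx].
Qed.

Lemma near_sqrtn_ge {R : realType} (x : R) : \forall n \near \oo, x < Num.sqrt n%:R.
Proof.
near=> n; apply: le_lt_trans (ler_norm _) _.
rewrite -sqrtr_sqr ltr_sqrt; first by near: n; exact: nbhs_infty_gtr.
by rewrite ltr0n; near: n; exact: nbhs_infty_gt.
Unshelve. all: by end_near. Qed.

Theorem theorem2 (R : realType) (dT : measure_display) (T : measurableType dT)
  (P : probability T R)
  (p p0 : nat) (d : 'I_p -> nat)
  (X : nat -> grouped R d) (Upsilon : 'M[R]_(\sum_j d j)%N)
  (beta0 : grouped R d)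
  (eps : nat -> {RV P >-> R}) (B : set R) (F f : R -> R)
  (Y : nat -> T -> R)
  (tau gamma : R) (mu : nat -> R)
  (btilde bhat : nat -> T -> grouped R d)
  (hp0 : (p0 <= p)%N)
  (hbeta0 : forall j : 'I_p, (enorm (submxcol beta0 j) != 0) = (j < p0)%N)
  (htau : 0 < tau < 1)
  (hY : forall i t, Y i t = dotv (X i) beta0 + eps i t)
  (A1 : design_assumption X Upsilon)
  (A2 : error_assumption X Upsilon tau eps B F f)
  (hgamma : 0 < gamma)
  (hmu : forall n, 0 < mu n)
  (hmu1 : mu n @[n --> \oo] --> +oo)
  (hmu2 : mu n / Num.sqrt n%:R @[n --> \oo] --> (0 : R))
  (hmu3 : n%:R `^ ((gamma - 1) / 2) * mu n @[n --> \oo] --> +oo)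
  (hmu4 : n%:R `^ (gamma / 2 - 1) * mu n @[n --> \oo] --> +oo)
  (mbtilde : forall n, random_vector (btilde n))
  (hbtilde : forall n t,
     is_argmin (quantile_loss tau n X (fun i => Y i t)) (btilde n t))
  (mbhat : forall n, random_vector (bhat n))
  (hbhat : forall n t,
     is_argmin (adaptive_loss tau gamma (mu n) n X (fun i => Y i t) (btilde n t))
       (bhat n t)) :
  P [set t | active_set (bhat n t) = active_set beta0] @[n --> \oo] --> 1%E.
Proof.
pose e t i : R := eps i t.
pose y t i : R := dotv (X i) beta0 + e t i.
have Yy t : (fun i => Y i t) = y t by apply/funext => i; rewrite hY.
have tau01 : 0 <= tau <= 1 by case/andP: htau => /ltW -> /ltW ->.
(* The selection event is measurable, so an outer bound on its complement bounds its probability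
   from below. *)
suff good x : 0 < x -> \forall n \near \oo, outer_prob_le P
    (~` [set t | active_set (bhat n t) = active_set beta0]) x.
  apply/fine_cvgP; split.
    by apply: nearW => n; rewrite fin_num_measure//; exact: measurable_active_set.
  apply/cvgrPdist_le => x x0; near=> n.
  have mS := measurable_active_set (active_set beta0) (mbhat n).
  have goodn : outer_prob_le P
      (~` [set t | active_set (bhat n t) = active_set beta0]) x.
    by near: n; exact: good.
  have := outer_prob_le_setC mS goodn; have := probability_le1 P mS.
  rewrite -(fineK (fin_num_measure P _ mS)) lee_fin /= => h1 h2.
  by rewrite ger0_norm; lra.
(* The budget [x] is shared by score, slope and curvature. Constants are chosen in the order [c] and
   [K], then [M], [L], [dl], the net and [xs]. *)
move=> x0; have x3 : 0 < x / 3 by rewrite divr_gt0.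
have [c c0 curv] := local_curv_large A1 A2.
have [K K0 score] := local_score_tight A1 A2 x3.
have m0 : 0 <= (4 + 3 * K) / c by rewrite divr_ge0 ?(ltW c0)//; lra.
(* With [m = M - 1 >= 1] this gives [c * m ^+ 2 = (4 + 3 * K + c) * m], which dominates
   [4 + K * (m + 2)]. *)
pose M := (4 + 3 * K) / c + 2.
have M1 : 1 < M by rewrite /M; lra.
have M0 : 0 < M by lra.
have cM : 4 + K * (M + 1) <= c * (M - 1) ^+ 2.
  have -> : M - 1 = (4 + 3 * K) / c + 1 by rewrite /M; lra.
  set m := (4 + 3 * K) / c + 1.
  have m1 : 1 <= m by rewrite /m; lra.
  have cm : c * m = 4 + 3 * K + c by rewrite /m; field; rewrite gt_eqF.
  rewrite expr2 mulrA cm; have -> : M + 1 = m + 2 by rewrite /M /m; lra.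
  by nra.
have M10 : 0 < M + 1 by lra.
have [L L0 slope] := local_slope_tight A1 A2 M10.
pose dl := (K + L + 1)^-1.
have KL : 0 < K + L + 1 by lra.
have dl01 : 0 <= dl <= 1.
  by rewrite invr_ge0 (ltW KL) invf_le1//; lra.
have dlKL : (K + L) * dl <= 1 by rewrite ler_pdivrMr//; lra.
have dl0 : 0 < dl by rewrite invr_gt0.
have [s net] := enorm_net (\sum_j d j)%N M dl0.
(* One share per net point; the [+ 1] covers an empty net. *)
pose xs := x / 3 / ((size s)%:R + 1).
have s1 : 0 < (size s)%:R + 1 :> R by rewrite ltr_wpDl.
have xs0 : 0 < xs by rewrite divr_gt0.
have curvs : \forall n \near \oo, {in s, forall v, outer_prob_le P
    [set t | local_curv n X (e t) v < c * enorm v ^+ 2 - 2] xs}.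
  by apply: near_in_seq => v _; exact: curv.
pose W := \sum_(j < p) (enorm (submxcol beta0 j) / 2) `^ (- gamma).
have W0 : 0 <= W by rewrite sumr_ge0// => j _; rewrite powR_ge0.
have WM : 0 < W * M + 1 by rewrite ltr_wpDl// mulr_ge0// ltW.
have large_beta : \forall n \near \oo, forall j, submxcol beta0 j != 0 ->
    M / Num.sqrt n%:R < enorm (submxcol beta0 j) / 2.
  apply: filter_forall => j; have [_|b0] := eqVneq (submxcol beta0 j) 0.
    exact: nearW.
  have b1 : 0 < enorm (submxcol beta0 j) by rewrite lt_def enorm_eq0 b0 enorm_ge0.
  apply: filterS (near_sqrtn_ge (2 * M / enorm (submxcol beta0 j))) => n.
  rewrite ltr_pdivrMr// => H _.
  have sn : 0 < Num.sqrt n%:R :> R.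
    by rewrite -(pmulr_lgt0 _ b1) (lt_trans _ H)// mulr_gt0.
  by rewrite ltr_pdivrMr//; lra.
(* The extra 1 beside [W * M] turns this into the strict inequality required later. *)
have small_pen : \forall n \near \oo, mu n / Num.sqrt n%:R * (W * M + 1) <= 1.
  have : \forall n \near \oo, mu n / Num.sqrt n%:R <= (W * M + 1)^-1.
    by move/cvgr_le: hmu2; apply; rewrite invr_gt0.
  by apply: filterS => n; rewrite -(ler_pM2r WM) mulVf ?gt_eqF.
have big_pen : \forall n \near \oo,
    (K + L) * M `^ gamma + 1 <= n%:R `^ ((gamma - 1) / 2) * mu n.
  by move/cvgryPge: hmu3; apply.
near=> n.
have n0 : (0 < n)%N by near: n; exact: nbhs_infty_gt.
have sn0 : 0 < Num.sqrt n%:R :> R by rewrite sqrtr_gt0 ltr0n.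
have large_betan : forall j, submxcol beta0 j != 0 ->
    M / Num.sqrt n%:R < enorm (submxcol beta0 j) / 2 by near: n.
have small_penn : mu n / Num.sqrt n%:R * W * M < 1.
  have : mu n / Num.sqrt n%:R * (W * M + 1) <= 1 by near: n.
  have : 0 < mu n / Num.sqrt n%:R by rewrite divr_gt0.
  lra.
have big_penn : (K + L) * Num.sqrt n%:R < mu n * (M / Num.sqrt n%:R) `^ (- gamma).
  have : (K + L) * M `^ gamma + 1 <= n%:R `^ ((gamma - 1) / 2) * mu n by near: n.
  have nR : 0 < n%:R :> R by rewrite ltr0n.
  have Mg : 0 < M `^ gamma by rewrite powR_gt0.
  (* Here [(sqrt n) ^ gamma = n ^ ((gamma - 1) / 2) * sqrt n]; the factor [sqrt n] then cancels
     against the left-hand side. *)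
  have -> : (M / Num.sqrt n%:R) `^ (- gamma) =
      n%:R `^ ((gamma - 1) / 2) * Num.sqrt n%:R / M `^ gamma.
    have sg : (Num.sqrt n%:R)^-1 `^ (- gamma) = n%:R `^ ((gamma - 1) / 2 + 2^-1) :> R.
      rewrite -powR12_sqrt ?(ltW nR)// -powRN -powRrM.
      by congr (_ `^ _); field.
    rewrite (powRM _ (ltW M0)) ?invr_ge0// sg powRD ?(gt_eqF nR) ?implybT//.
    by rewrite powR12_sqrt ?(ltW nR)// powRN mulrC.
  move=> H; have sM : 0 < Num.sqrt n%:R / M `^ gamma by rewrite divr_gt0.
  have : (K + L) * M `^ gamma < n%:R `^ ((gamma - 1) / 2) * mu n by lra.
  rewrite -(ltr_pM2r sM); congr (_ < _); last by ring.
  by field; rewrite gt_eqF.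
have scoren : outer_prob_le P
    [set t | K < enorm (local_score tau n X (e t))] (x / 3) by near: n.
have slopen : outer_prob_le P
    [set t | L < local_slope n X (e t) (M + 1)] (x / 3) by near: n; exact: slope.
have curvn : {in s, forall v, outer_prob_le P
    [set t | local_curv n X (e t) v < c * enorm v ^+ 2 - 2] xs} by near: n.
have := outer_prob_leU (outer_prob_leU scoren slopen) (outer_prob_le_bigcup curvn).
move=> bad; apply: outer_prob_leS (outer_prob_le_trans _ bad); last first.
  have : (size s)%:R * xs <= x / 3.
    by rewrite /xs mulrCA ger_pMr// ler_pdivrMr//; lra.
  lra.
move=> t /= wrong; apply: contrapT => ok; apply: wrong.
have scoret : enorm (local_score tau n X (e t)) <= K.
  by rewrite leNgt; apply/negP => h; apply: ok; left; left.
have slopet : local_slope n X (e t) (M + 1) <= L.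
  by rewrite leNgt; apply/negP => h; apply: ok; left; right.
have curvt : {in s, forall v, c * enorm v ^+ 2 - 2 <= local_curv n X (e t) v}.
  by move=> v vs; rewrite leNgt; apply/negP => h; apply: ok; right; exists v.
have coer := local_loss_coercive tau01 M1 (ltW c0) dl01 scoret slopet dlKL cM net curvt.
have lip u v : enorm u <= M -> enorm v <= M ->
    `|local_loss tau n X (e t) u - local_loss tau n X (e t) v| <=
      (K + L) * enorm (u - v).
  move=> uM vM.
  have uM1 : enorm u <= M + 1 by lra.
  have vM1 : enorm v <= M + 1 by lra.
  apply: le_trans (local_loss_lip tau n X (e t) uM1 vM1) _.
  by rewrite ler_wpM2r ?enorm_ge0// lerD.
apply: (active_set_selection n0 hgamma (hmu n) M0 coer lip large_betan small_penn big_penn).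
  by rewrite -[X in quantile_loss _ _ _ X]Yy.
by rewrite -[X in adaptive_loss _ _ _ _ _ X]Yy.
Unshelve. all: by end_near. Qed.
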